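(* For $\mu\in\mathcal{P}_c(\mathbb{R})$ let $B(\mu)=\sup\{x:\mu((-\infty,x])\le\frac12\}$ and $\eta(\mu)=\mu((-\infty,B(\mu)])-\frac12$, and let $V$ be the Probability Vector Field $V[\mu]=\mu\otimes\nu_x$ with $\nu_x=\delta_{-1}$ if $x<B(\mu)$, $\nu_x=\delta_1$ if $x>B(\mu)$, and, if $\mu(\{B(\mu)\})>0$, $$\nu_{B(\mu)}=\frac{1}{\mu(\{B(\mu)\})}\Big(\eta(\mu)\,\delta_1+\big(\tfrac12-\mu((-\infty,B(\mu)))\big)\,\delta_{-1}\Big).$$ Then $V$ is support sublinear and locally $\mathcal{W}$-Lipschitz, and Lattice Approximate Solutions admit a unique limit; thus, for every $T>0$, there exists a unique Lipschitz semigroup on $[0,T]\times\mathcal{P}_c(\mathbb{R})$ for $\dot\mu=V[\mu]$ whose trajectories are limits of Lattice Approximate Solutions. Moreover, for every $\mu_0\in\mathcal{P}_c(\mathbb{R})$, writing $B=B(\mu_0)$ and $\eta=\eta(\mu_0)$, the solution to $\dot\mu=V[\mu]$, $\mu(0)=\mu_0$, obtained as limit of Lattice Approximate Solutions satisfies, for every Borel set $A\subset\mathbb{R}$, $$\mu(t)(A)=\mu_0\big((A\cap(-\infty,B-t))+t\big)+\mu_0\big((A\cap(B+t,+\infty))-t\big)+\eta\,\delta_{B+t}(A)+\big(\tfrac12-\mu_0((-\infty,B))\big)\,\delta_{B-t}(A).$$ In particular: (i) if $\mu_0=\delta_{x_0}$ then $\mu(t)=\frac12\delta_{x_0+t}+\frac12\delta_{x_0-t}$;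 (ii) if $\mu_0=\frac{1}{b-a}\chi_{[a,b]}\lambda$ with $a<b$ and $\lambda$ the Lebesgue measure, then $\mu(t)=\frac{1}{b-a}\big(\chi_{[a-t,\frac{a+b}{2}-t]}+\chi_{[\frac{a+b}{2}+t,b+t]}\big)\lambda$.
   Context: Here $n=1$. $T\mathbb{R}=\mathbb{R}\times\mathbb{R}$ with points $(x,v)$, $\pi_1(x,v)=x$, $\pi_{13}(x,v,y,w)=(x,y)$. $\mathcal{P}(X)$: Borel probability measures; $\mathcal{P}_c(X)$: those with compact support. $P(\mu,\nu)$ is the set of couplings of $\mu,\nu$; $W$ is the 1-Wasserstein metric on $\mathbb{R}$ and $P^{opt}(\mu,\nu)$ the set of couplings minimizing $\int|x-y|\,d\tau$. $B(0,R)$ is the ball of radius $R$ centered at $0$. $\mu\otimes\nu_x$ denotes the measure with $\int\phi\,d(\mu\otimes\nu_x)=\int\int\phi(x,v)\,d\nu_x(v)\,d\mu(x)$. A Probability Vector Field (PVF) $V$ assigns to $\mu$ a probability measure $V[\mu]$ on $T\mathbb{R}$ with $\pi_1\#V[\mu]=\mu$. It is support sublinear with constant $C>0$ if for every $\mu\in\mathcal{P}_c(\mathbb{R})$: $\sup_{(x,v)\in \mathrm{Supp}(V[\mu])}|v|\le C(1+\sup_{x\in \mathrm{Supp}(\mu)}|x|)$. For $V_1,V_2\in\mathcal{P}_c(T\mathbb{R})$ with $\mu_i=\pi_1\#V_i$, $$\mathcal{W}(V_1,V_2)=\inf\Big\{\int|v-w|\,dT(x,v,y,w): T\in P(V_1,V_2),\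 \pi_{13}\#T\in P^{opt}(\mu_1,\mu_2)\Big\}.$$ $V$ is locally $\mathcal{W}$-Lipschitz if for every $R>0$ there is $K=K(R)>0$ with $\mathcal{W}(V[\mu],V[\nu])\le K\,W(\mu,\nu)$ whenever $\mathrm{Supp}(\mu),\mathrm{Supp}(\nu)\subset B(0,R)$. Solution: $\mu:[0,T]\to\mathcal{P}_c(\mathbb{R})$ is a solution to $\dot\mu=V[\mu]$ if for every $f\in C_c^\infty(\mathbb{R})$: $\int_{T\mathbb{R}}f'(x)v\,dV[\mu(s)](x,v)$ is defined for a.e. $s$ and is $L^1$ in $s\in[0,T]$, $t\mapsto\int f\,d\mu(t)$ is absolutely continuous, and for a.e. $t$, $\frac{d}{dt}\int f\,d\mu(t)=\int_{T\mathbb{R}}f'(x)v\,dV[\mu(t)](x,v)$. Lipschitz semigroup for $\dot\mu=V[\mu]$: a map $S:[0,T]\times\mathcal{P}_c(\mathbb{R})\to\mathcal{P}_c(\mathbb{R})$ such that for all $\mu,\nu\in\mathcal{P}_c(\mathbb{R})$ and $t,s\in[0,T]$: (1) $S_0\mu=\mu$ and $S_tS_s\mu=S_{t+s}\mu$ (when $t+s\le T$); (2) $t\mapsto S_t\mu$ is a solution to $\dot\mu=V[\mu]$; (3) for every $R>0$ there is $C(R)>0$ such that if $\mathrm{Supp}(\mu),\mathrm{Supp}(\nu)\subset B(0,R)$ then $\mathrm{Supp}(S_t\mu)\subset B(0,e^{Ct}(R+1))$ (with $C$ the support-sublinearity constant), $W(S_t\mu,S_t\nu)\le e^{C(R)t}W(\mu,\nu)$,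 and $W(S_t\mu,S_s\mu)\le C(R)|t-s|$. Lattice Approximate Solutions (LAS) with initial datum $\mu_0\in\mathcal{P}_c(\mathbb{R})$: for $N\in\mathbb{N}$ let $\Delta_N=1/N$, let $x_i$ be the points of $(\mathbb{Z}/N^2)\cap[-N,N]$ and $v_j$ the points of $(\mathbb{Z}/N)\cap[-N,N]$. Set $\mu^N_0=\sum_i\mu_0(x_i+[0,N^{-2}))\,\delta_{x_i}$. Recursively, given $\mu^N_\ell$ supported on the points $x_i$, put $m_{ij}=V[\mu^N_\ell](\{(x_i,v): v\in v_j+[0,N^{-1})\})$ and, for $t\in[0,\Delta_N]$, $\mu^N(\ell\Delta_N+t)=\sum_{i,j}m_{ij}\,\delta_{x_i+t v_j}$, with $\mu^N_{\ell+1}=\mu^N((\ell+1)\Delta_N)$. This is considered for $N$ large enough that all mass stays within the grids on $[0,T]$. Limits of LASs as $N\to\infty$ are uniform on $[0,T]$ for $W$; ''trajectories are limits of LASs'' means that each $t\mapsto S_t\mu_0$ is a limit of (a subsequence of) the LASs with initial datum $\mu_0$. *)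

(* Defs.v *)
From HB Require Import structures.
From mathcomp Require Import all_boot all_order all_algebra.
From mathcomp Require Import all_classical all_reals all_analysis.
From mathcomp Require Import measurable_realfun lra.

Set Implicit Arguments.
Unset Strict Implicit.
Unset Printing Implicit Defensive.

Import Order.TTheory GRing.Theory Num.Theory.
Import numFieldNormedType.Exports.

Local Open Scope classical_set_scope.
Local Open Scope ring_scope.

(** ** Measures on the line and on its tangent bundle [R * R] *)

(* Values outside the sigma-algebra carry no information, so measures are
   compared on measurable sets and never with Leibniz equality. *)
Definition eq_meas d (X : measurableType d) (R : realType)
    (mu nu : set X -> \bar R) : Prop :=
  forall A, measurable A -> mu A = nu A.

Definition Supp (X : topologicalType) (R : realType) (mu : set X -> \bar R) :
    set X :=
  [set x | forall U, open U -> U x -> (0 < mu U)%E].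

Record Pc (R : realType) := MkPc {
  Pc_prob :> probability R R ;
  Pc_compact : compact (Supp Pc_prob) }.

(** ** Couplings, the 1-Wasserstein metric and the pseudo-distance between
    probability measures on the tangent bundle *)

Definition couplings d d' (X : measurableType d) (Y : measurableType d')
    (R : realType) (mu : set X -> \bar R) (nu : set Y -> \bar R) :
    set (probability (X * Y)%type R) :=
  [set tau | eq_meas (pushforward tau fst) mu /\
             eq_meas (pushforward tau snd) nu].

Definition transport_cost (R : realType) (tau : set (R * R) -> \bar R) :
    \bar R :=
  (\int[tau]_z `|z.1 - z.2|%:E)%E.

Definition W1 (R : realType) (mu nu : set R -> \bar R) : \bar R :=
  ereal_inf [set transport_cost tau | tau in couplings mu nu].

Definition opt_couplings (R : realType) (mu nu : set R -> \bar R) :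
    set (probability (R * R)%type R) :=
  [set tau | couplings mu nu tau /\
     forall tau', couplings mu nu tau' ->
       (transport_cost tau <= transport_cost tau')%E].

Definition pi13 (R : realType) (z : (R * R) * (R * R)) : R * R :=
  (z.1.1, z.2.1).

Definition calW (R : realType) (V1 V2 : probability (R * R)%type R) : \bar R :=
  ereal_inf [set (\int[T]_z `|z.1.2 - z.2.2|%:E)%E | T in
    [set T | couplings V1 V2 T /\
       exists2 tau : probability (R * R)%type R,
         opt_couplings (pushforward V1 fst) (pushforward V2 fst) tau &
         eq_meas (pushforward T (@pi13 R)) tau]].

(** ** Probability vector fields *)

Definition is_PVF (R : realType)
    (V : probability R R -> probability (R * R)%type R) : Prop :=
  forall mu, eq_meas (pushforward (V mu) fst) mu.

(* The suprema are taken in the extended reals: the real [sup] is 0 on an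
   unbounded set. *)
Definition support_sublinear (R : realType)
    (V : probability R R -> probability (R * R)%type R) (C : R) : Prop :=
  forall mu : Pc R,
    (ereal_sup [set `|p.2|%:E | p in Supp (V mu)] <=
     C%:E * (1 + ereal_sup [set `|x|%:E | x in Supp mu]))%E.

Definition locally_calW_Lipschitz (R : realType)
    (V : probability R R -> probability (R * R)%type R) : Prop :=
  forall r : R, 0 < r -> exists2 K : R, 0 < K &
    forall mu nu : Pc R,
      Supp mu `<=` ball (0 : R) r -> Supp nu `<=` ball (0 : R) r ->
      (calW (V mu) (V nu) <= K%:E * W1 mu nu)%E.

(** ** Solutions *)

Definition test_function (R : realType) (f : R -> R) : Prop :=
  (forall n x, derivable (derive1n n f) x 1) /\ compact (closure [set x | f x != 0]).

Definition abs_continuous (R : realType) (a b : R) (g : R -> R) : Prop :=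
  forall e : R, 0 < e -> exists2 d : R, 0 < d &
    forall n (u v : 'I_n -> R),
      (forall i, a <= u i /\ u i <= v i /\ v i <= b) ->
      (forall i j, i != j -> v i <= u j \/ v j <= u i) ->
      \sum_(i < n) (v i - u i) < d ->
      \sum_(i < n) `|g (v i) - g (u i)| < e.

(* [h] is a Borel representative of the almost everywhere defined function
   [s |-> \int f'(x) v dV[mu(s)](x, v)]. *)
Definition is_solution (R : realType)
    (V : probability R R -> probability (R * R)%type R) (T : R)
    (mu : R -> Pc R) : Prop :=
  forall f : R -> R, test_function f ->
    let rhs s := (\int[V (mu s)]_p (derive1 f p.1 * p.2))%R in
    let pairing t := (\int[mu t]_x f x)%R in
    [/\ exists h : R -> R,
          lebesgue_measure.-integrable `[0, T] (EFin \o h) /\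
          {ae lebesgue_measure, forall s, s \in `[0, T] ->
            (V (mu s)).-integrable setT (fun p => (derive1 f p.1 * p.2)%:E) /\
            rhs s = h s},
        abs_continuous 0 T pairing &
        {ae lebesgue_measure, forall t, t \in `[0, T] ->
          is_derive t 1 pairing (rhs t)}].

(** ** Lipschitz semigroups *)

(* [C] is the support-sublinearity constant of [V]. *)
Definition Lipschitz_semigroup (R : realType)
    (V : probability R R -> probability (R * R)%type R) (C T : R)
    (S : R -> Pc R -> Pc R) : Prop :=
  [/\ (forall mu : Pc R, eq_meas (S 0 mu) mu) /\
      (forall (mu : Pc R) t s, 0 <= t -> 0 <= s -> t + s <= T ->
         eq_meas (S t (S s mu)) (S (t + s) mu)),
      forall mu : Pc R, is_solution V T (fun t => S t mu) &
      forall r : R, 0 < r -> exists2 Cr : R, 0 < Cr &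
        forall mu nu : Pc R,
          Supp mu `<=` ball (0 : R) r -> Supp nu `<=` ball (0 : R) r ->
          forall t s, t \in `[0, T] -> s \in `[0, T] ->
          [/\ Supp (S t mu) `<=` ball (0 : R) (expR (C * t) * (r + 1)),
              (W1 (S t mu) (S t nu) <= (expR (Cr * t))%:E * W1 mu nu)%E &
              (W1 (S t mu) (S s mu) <= (Cr * `|t - s|)%:E)%E]].

(** ** Lattice approximate solutions *)

(* The points of (Z / N^2) \cap [-N, N] and of (Z / N) \cap [-N, N], in
   increasing order. *)
Definition xgrid (R : realType) (N : nat) (i : 'I_(2 * N ^ 3).+1) : R :=
  (i%:R - (N ^ 3)%:R) / (N ^ 2)%:R.

Definition vgrid (R : realType) (N : nat) (j : 'I_(2 * N ^ 2).+1) : R :=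
  (j%:R - (N ^ 2)%:R) / N%:R.

(* [mu] is the lattice approximate solution with [N] as discretization
   parameter. Its values being probability measures, no mass ever leaves the
   grids on the time interval [0, T]. *)
Definition is_LAS (R : realType)
    (V : probability R R -> probability (R * R)%type R) (T : R) (N : nat)
    (mu0 : Pc R) (mu : R -> probability R R) : Prop :=
  (forall A, measurable A ->
     mu 0 A = (\sum_(i < (2 * N ^ 3).+1)
       mu0 `[xgrid R i, (xgrid R i + (N ^ 2)%:R^-1)%R[%classic *
       \d_(xgrid R i) A)%E) /\
  (forall (l : nat) (t : R), 0 <= t <= N%:R^-1 -> l%:R / N%:R + t <= T ->
     forall A, measurable A ->
     mu (l%:R / N%:R + t) A =
       (\sum_(i < (2 * N ^ 3).+1) \sum_(j < (2 * N ^ 2).+1)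
         V (mu (l%:R / N%:R)%R)
           ([set xgrid R i] `*` `[vgrid R j, (vgrid R j + N%:R^-1)%R[%classic) *
         \d_(xgrid R i + t * vgrid R j)%R A)%E).

(* The lattice approximate solutions of parameters [phi k] exist for [k] large
   and converge to [mu] for [W1], uniformly on [0, T]. *)
Definition LAS_converge (R : realType)
    (V : probability R R -> probability (R * R)%type R) (T : R)
    (phi : nat -> nat) (mu0 : Pc R) (mu : R -> Pc R) : Prop :=
  exists muN : nat -> R -> probability R R,
    (\forall k \near \oo, is_LAS V T (phi k) mu0 (muN k)) /\
    (forall e : R, 0 < e -> \forall k \near \oo,
       forall t, t \in `[0, T] -> (W1 (muN k t) (mu t) < e%:E)%E).

Definition LAS_limit (R : realType)
    (V : probability R R -> probability (R * R)%type R) (T : R)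
    (mu0 : Pc R) (mu : R -> Pc R) : Prop :=
  exists2 phi : nat -> nat, {homo phi : m n / (m < n)%N} &
    LAS_converge V T phi mu0 mu.

(* Convergence of the whole sequence, every limit of a subsequence being the
   same curve on [0, T]. *)
Definition LAS_unique_limit (R : realType)
    (V : probability R R -> probability (R * R)%type R) (T : R)
    (mu0 : Pc R) : Prop :=
  exists2 mu : R -> Pc R, LAS_converge V T id mu0 mu &
    forall mu' : R -> Pc R, LAS_limit V T mu0 mu' ->
      forall t, t \in `[0, T] -> eq_meas (mu' t) (mu t).

Definition LAS_semigroup (R : realType)
    (V : probability R R -> probability (R * R)%type R) (C T : R)
    (S : R -> Pc R -> Pc R) : Prop :=
  Lipschitz_semigroup V C T S /\
  forall mu0 : Pc R, LAS_limit V T mu0 (fun t => S t mu0).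

(** ** The measure \mu \otimes \nu_x *)

Definition otimes d1 d2 (T1 : measurableType d1) (T2 : measurableType d2)
    (R : realType) (mu : set T1 -> \bar R)
    (nu : T1 -> {measure set T2 -> \bar R}) :
    set (T1 * T2) -> \bar R :=
  fun A => (\int[mu]_x \int[nu x]_v (\1_A (x, v))%:E)%E.

Section otimes_probability.
Local Open Scope ereal_scope.
Context d1 d2 (T1 : measurableType d1) (T2 : measurableType d2) (R : realType).
Variables (mu : probability T1 R) (nu : R.-pker T1 ~> T2).

Let cst_mu : unit -> pprobability T1 R := cst mu.

Let mcst_mu : measurable_fun setT cst_mu.
Proof. exact: measurable_cst. Qed.

Let otimesE A : otimes mu nu A =
  mkproduct (kprobability mcst_mu) (kernel.kernel_snd nu) tt A.
Proof. by []. Qed.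

Let otimes0 : otimes mu nu set0 = 0.
Proof. by rewrite otimesE measure0. Qed.

Let otimes_ge0 A : 0 <= otimes mu nu A.
Proof. by rewrite otimesE measure_ge0. Qed.

Let otimes_sigma_additive : semi_sigma_additive (otimes mu nu).
Proof.
exact: (@measure_semi_sigma_additive _ _ _
  (mkproduct (kprobability mcst_mu) (kernel.kernel_snd nu) tt)).
Qed.

HB.instance Definition _ := isMeasure.Build _ _ _ (otimes mu nu)
  otimes0 otimes_ge0 otimes_sigma_additive.

Let otimesT : otimes mu nu setT = 1.
Proof.
rewrite /otimes; under eq_integral.
  move=> x _; rewrite indicT/= integral_cst//= mul1e prob_kernel.
  over.
by rewrite integral_cst//= mul1e probability_setT.
Qed.

HB.instance Definition _ :=
  Measure_isProbability.Build _ _ _ (otimes mu nu) otimesT.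

End otimes_probability.

(** ** The vector field splitting the mass at its median *)

Definition Bpt (R : realType) (mu : set R -> \bar R) : R :=
  sup [set x | (mu `]-oo, x]%classic <= (2^-1)%:E)%E].

Definition eta_of (R : realType) (mu : set R -> \bar R) : R :=
  fine (mu `]-oo, Bpt mu]%classic) - 2^-1.

(* The value at [Bpt mu] is irrelevant when this point is not an atom. *)
Definition nu_split (R : realType) (mu : set R -> \bar R) (x : R) :
    set R -> \bar R :=
  fun A =>
    (if (x < Bpt mu)%R then \d_(-1 : R)%R A
     else if (Bpt mu < x)%R then \d_(1 : R)%R A
     else if 0 < mu [set Bpt mu] then
       ((fine (mu [set Bpt mu]))^-1)%:E *
       ((eta_of mu)%:E * \d_(1 : R)%R A +
        (2^-1 - fine (mu `]-oo, Bpt mu[%classic))%:E * \d_(-1 : R)%R A)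
     else \d_(1 : R)%R A)%E.

Section median.
Context (R : realType) (mu : probability R R).

Let idR : R -> R := idfun.
HB.instance Definition _ :=
  @isMeasurableFun.Build _ _ _ _ idR (@measurable_id _ _ setT).
Let X : {RV mu >-> R} := idR.
Let F (x : R) := mu `]-oo, x]%classic.
Let E := [set x | (F x <= (2^-1)%:E)%E].

Let F_nd x y : x <= y -> (F x <= F y)%E.
Proof. by move=> xy; exact: (cdf_nondecreasing X). Qed.

Let half_gt0 : (0 : R) < 2^-1.
Proof. by rewrite invr_gt0 ltr0n. Qed.

Let half_lt1 : (2^-1 : R) < 1.
Proof. by rewrite invf_lt1// ltr1n. Qed.

Let E_has_sup : has_sup E.
Proof.
split; apply: contrapT => nE.
- have : ((2^-1)%:E <= (0 : \bar R))%E.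
    apply: (cvge_to_ge (cvg_cdfNy0 X)); near=> x.
    by rewrite leNgt; apply/negP => /ltW Fx; apply: nE; exists x.
  by rewrite lee_fin leNgt half_gt0.
- have : ((1 : \bar R) <= (2^-1)%:E)%E.
    apply: (cvge_to_le (cvg_cdfy1 X)); near=> x.
    rewrite leNgt; apply/negP => Fx; apply: nE; exists x => y Ey.
    rewrite leNgt; apply/negP => /ltW/F_nd xy.
    by have := lt_le_trans Fx (le_trans xy Ey); rewrite ltxx.
  by rewrite lee_fin leNgt half_lt1.
Unshelve. all: by end_near. Qed.

Lemma half_le_Bpt : ((2^-1)%:E <= mu `]-oo, Bpt mu]%classic)%E.
Proof.
apply: (cvge_to_ge (@cdf_right_continuous _ _ _ mu X (Bpt mu))).
near=> x; rewrite leNgt; apply/negP => /ltW Fx.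
have : x <= Bpt mu by apply: ub_le_sup => //; case: E_has_sup.
by rewrite leNgt => /negP; apply; near: x; exact: nbhs_right_gt.
Unshelve. all: by end_near. Qed.

Lemma lt_Bpt_le_half : (mu `]-oo, Bpt mu[%classic <= (2^-1)%:E)%E.
Proof.
pose G n := `]-oo, (Bpt mu - n.+1%:R^-1)]%classic : set R.
have GE : \bigcup_n G n = `]-oo, Bpt mu[%classic.
  apply/seteqP; split=> [x [n _]|x]; rewrite /G /= !in_itv/=.
    by move=> /le_lt_trans; apply; rewrite ltrBlDr ltrDl.
  by move=> /ltr_add_invr[k xk]; exists k => //=; rewrite in_itv/= lerBrDr ltW.
have cG : mu (G n) @[n --> \oo] --> mu (\bigcup_n G n).
  apply: nondecreasing_cvg_mu => //.
  - by move=> n; exact: measurable_itv.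
  - by apply: bigcup_measurable => n _; exact: measurable_itv.
  - move=> m n mn; apply/subsetPset; apply: subset_itvl.
    by rewrite bnd_simp lerD2l lerN2 lef_pV2 ?posrE// ler_nat.
rewrite -GE; apply: (cvge_to_le cG); near=> n.
have n0 : (0 : R) < n.+1%:R^-1 by rewrite invr_gt0.
have [e Ee ne] := sup_adherent n0 E_has_sup.
exact: le_trans (F_nd (ltW ne)) Ee.
Unshelve. all: by end_near. Qed.

Lemma Bpt_atom : (mu `]-oo, Bpt mu]%classic =
  mu `]-oo, Bpt mu[%classic + mu [set Bpt mu])%E.
Proof.
rewrite -measureU//; first by rewrite setUitv1.
by apply/seteqP; split=> x //= [] /[swap] ->; rewrite in_itv/= ltxx.
Qed.

Lemma eta_ge0 : 0 <= eta_of mu.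
Proof.
rewrite /eta_of subr_ge0 -lee_fin fineK ?fin_num_measure//.
exact: half_le_Bpt.
Qed.

Lemma half_lt_Bpt_ge0 : 0 <= 2^-1 - fine (mu `]-oo, Bpt mu[%classic).
Proof.
rewrite subr_ge0 -lee_fin fineK ?fin_num_measure//.
exact: lt_Bpt_le_half.
Qed.

Lemma eta_half_lt_Bpt :
  eta_of mu + (2^-1 - fine (mu `]-oo, Bpt mu[%classic)) =
  fine (mu [set Bpt mu]).
Proof.
by rewrite /eta_of Bpt_atom fineD ?fin_num_measure//; lra.
Qed.

End median.

Section nu_split_kernel.
Local Open Scope ereal_scope.
Context (R : realType) (mu : probability R R).

Let nu_split_measure x : exists m : {measure set R -> \bar R},
  nu_split mu x = m.
Proof.
rewrite /nu_split; case: (x < Bpt mu)%R; first by exists \d_(-1 : R)%R.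
case: (Bpt mu < x)%R; first by exists \d_(1 : R)%R.
case: (0 < mu [set Bpt mu]); last by exists \d_(1 : R)%R.
have m0 : (0 <= (fine (mu [set Bpt mu]))^-1)%R by rewrite invr_ge0 fine_ge0.
exists (mscale (NngNum m0) (measure_add
  (mscale (NngNum (eta_ge0 mu)) \d_(1 : R)%R)
  (mscale (NngNum (half_lt_Bpt_ge0 mu)) \d_(-1 : R)%R))).
by apply/funext => A; rewrite /= /mscale/= /msum 2!big_ord_recl/= big_ord0 adde0.
Qed.

Let nu_split0 x : nu_split mu x set0 = 0.
Proof. by have [m ->] := nu_split_measure x. Qed.

Let nu_split_ge0 x A : 0 <= nu_split mu x A.
Proof. by have [m ->] := nu_split_measure x. Qed.

Let nu_split_sigma_additive x : semi_sigma_additive (nu_split mu x).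
Proof.
by have [m ->] := nu_split_measure x; exact: measure_semi_sigma_additive.
Qed.

HB.instance Definition _ x := isMeasure.Build _ _ _ (nu_split mu x)
  (nu_split0 x) (nu_split_ge0 x) (@nu_split_sigma_additive x).

Definition nu_kernel : R -> {measure set R -> \bar R} := nu_split mu.

Let measurable_nu_kernel U : measurable U ->
  measurable_fun [set: R] (nu_kernel ^~ U).
Proof.
move=> mU; apply: measurable_fun_ifT => //.
  exact: measurable_fun_ltr.
by apply: measurable_fun_ifT => //; exact: measurable_fun_ltr.
Qed.

HB.instance Definition _ := isKernel.Build _ _ _ _ _ nu_kernel
  measurable_nu_kernel.

Let nu_kernelT x : nu_kernel x setT = 1.
Proof.
rewrite /nu_kernel/= /nu_split !diracT.
case: ifP => // _; case: ifP => // _; case: ifP => // B0.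
rewrite !mule1 -EFinD eta_half_lt_Bpt -EFinM mulVf// gt_eqF//.
by rewrite fine_gt0// B0 ltey_eq fin_num_measure.
Qed.

HB.instance Definition _ := Kernel_isProbability.Build _ _ _ _ _
  nu_kernel nu_kernelT.

End nu_split_kernel.

Definition V_split (R : realType) (mu : probability R R) :
    probability (R * R)%type R :=
  otimes mu (nu_kernel mu).

(* Main.v *)
(* Every compactly supported measure is the law of a nondecreasing function g on
   the unit interval endowed with the uniform probability. In these coordinates
   the median is the level 1/2, and V[mu] is the law of u |-> (g u, s u) where
   s = -1 below 1/2 and s = 1 above. As g + t s is again nondecreasing for
   0 <= t, the mass moves at constant velocity s: the candidate solution is the
   law of g + t s, and W (mu, nu) is the L^1 distance of the rearrangements,
   which is preserved by the motion. The coupling of (g, s) with (h, s) has a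
   vanishing velocity cost. Velocities being +1 or -1, lattice points are moved
   to lattice points, so a lattice approximate solution is exactly the law of
   g_N + t s, where g_N rounds g down to the grid, at distance at most 1/N from
   the law of g + t s. *)

Require Import Defs.
From HB Require Import structures.
From mathcomp Require Import all_boot all_order all_algebra.
From mathcomp Require Import all_classical all_reals all_analysis.
From mathcomp Require Import measurable_realfun lra ring.

Set Implicit Arguments.
Unset Strict Implicit.
Unset Printing Implicit Defensive.

Import Order.TTheory GRing.Theory Num.Theory.
Import numFieldNormedType.Exports.

Local Open Scope classical_set_scope.
Local Open Scope ring_scope.

(** The crux is that monotonicity survives the motion. The field is computed from any nondecreasing
    rearrangement, and the left half moves left while the right half moves right, so that [g], and
    likewise its rounding to the grid, stays nondecreasing at all later times and the same
    computation of the field applies again. This yields both the semigroup law and the induction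
    over the lattice steps. Rearrangements are unique only up to null sets of levels, so identities
    between measures are obtained from almost everywhere identities between functions of the level;
    the level [1/2], where the velocity jumps, is harmless for this reason. Uniqueness concerns
    limits: the recursion leaves a single approximate solution for each large [N], and the [L^1]
    expression of [W1] then identifies the rearrangement of the limit almost everywhere. The
    semigroup is required for every sublinearity constant [C]. Mass moves at unit speed, and could
    leave the prescribed balls if [C] were small; a Dirac mass shows that [C] is at least [1]. *)

Section measure_facts.
Context d (X : measurableType d) (R : realType).
Variable m : {measure set X -> \bar R}.

Lemma ae_le_measure (A B : set X) : measurable A -> measurable B ->
  {ae m, forall x, A x -> B x} -> (m A <= m B)%E.
Proof.
move=> mA mB [N [mN N0 AB]].
rewrite -[leRHS]adde0 -N0; apply: le_trans (measureU2 _ mB mN).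
apply: le_measure; rewrite ?inE//; first exact: measurableU.
move=> x Ax; apply: contrapT => /not_orP[Bx Nx]; apply: Nx; apply: AB.
by move=> /(_ Ax).
Qed.

Lemma ae_eq_measure (A B : set X) : measurable A -> measurable B ->
  {ae m, forall x, A x <-> B x} -> m A = m B.
Proof.
move=> mA mB AB; apply/eqP; rewrite eq_le; apply/andP.
by split; apply: ae_le_measure => //; apply: filterS AB => x [].
Qed.

Lemma measure_split_fin (I : finType) (Z : I -> set X) (B : set X) :
  (forall i, measurable (Z i)) -> measurable B ->
  (forall x, exists i, Z i x) -> (forall i j x, Z i x -> Z j x -> i = j) ->
  m B = (\sum_(i : I) m (Z i `&` B))%E.
Proof.
move=> mZ mB ZT Zinj.
have -> : B = \bigcup_(i in [set: I]) (Z i `&` B).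
  apply/seteqP; split => [x Bx|x [i _ []]//].
  by have [i Zi] := ZT x; exists i.
rewrite measure_fin_bigcup//.
- rewrite (fsbigE (index_enum I)) ?index_enum_uniq//=; last first.
    by move=> i _; rewrite mem_index_enum.
  apply: eq_big => [i|i _]; first by rewrite in_setT.
  congr (m _); apply/seteqP; split => [x [Zx Bx]|x [Zx [j _ [_ Bx]]]] //.
  by split => //; exists i.
- exact: finite_finset.
- by move=> i j _ _ [x [[Zi _] [Zj _]]]; exact: Zinj Zi Zj.
- by move=> i _; exact: measurableI.
Qed.

End measure_facts.

(** Both lattice sums have this shape: [Z i] is the set of levels falling into the cell [i], and
    [c i] the point to which the mass of that cell is sent. Since [F] is constant on each cell, the
    weighted Dirac masses add up to the law of [F]. *)
Lemma sum_dirac_partition d (X : measurableType d) (R : realType)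
    (m : {measure set X -> \bar R}) (I : finType) (Z : I -> set X)
    (c : I -> R) (F : X -> R) (A : set R) :
  measurable_fun setT F -> measurable A -> (forall i, measurable (Z i)) ->
  (forall x, exists i, Z i x) -> (forall i j x, Z i x -> Z j x -> i = j) ->
  (forall i x, Z i x -> F x = c i) ->
  (\sum_(i : I) m (Z i) * \d_(c i) A = m (F @^-1` A))%E.
Proof.
move=> mF mA mZ ZT Zinj Fc.
have mFA : measurable (F @^-1` A) by rewrite -[_ @^-1` _]setTI; exact: mF.
rewrite [RHS](measure_split_fin _ mZ)//; apply: eq_bigr => i _.
rewrite diracE; have [cA|cA] := boolP (c i \in A).
  rewrite mule1; congr (m _); apply/seteqP; split => [x Zx|x []//].
  by split => //=; rewrite (Fc _ _ Zx) -in_setE.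
rewrite mule0 (_ : _ `&` _ = set0) ?measure0//.
by apply/seteqP; split => // x [Zx /=];
  rewrite (Fc _ _ Zx) -in_setE (negbTE cA).
Qed.

(** The half-open intervals form a generating family stable under intersection, and the mass of []a,
    b]] is a difference of two values of the distribution function. *)
Lemma probability_cdf_inj (R : realType) (m1 m2 : probability R R) :
  (forall x, m1 `]-oo, x] = m2 `]-oo, x])%classic -> eq_meas m1 m2.
Proof.
move=> m12 A mA.
pose g n := `](- n%:R : R), n%:R]%classic.
apply: (measure_unique (@ocitv R) g) => //.
- exact: ocitvI.
- by move=> i; exact: is_ocitv.
- exact: bigcup_itvT.
- move=> _ [[a b] _ <-] /=.
  have E (m : probability R R) : a <= b ->
      m `]a, b]%classic = (m `]-oo, b]%classic - m `]-oo, a]%classic)%E.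
    move=> ab; rewrite (_ : `]a, b]%classic = `]-oo, b] `\` `]-oo, a]);
      last first.
      by rewrite -[RHS]setCK setCD setCitvl setUC -[LHS]setCK setCitv.
    rewrite measureD ?setIidr//; first exact: subset_itvl.
    by rewrite -ge0_fin_numE// fin_num_measure.
  have [ab|ba] := leP a b; first by rewrite !E// !m12.
  by rewrite set_itv_ge ?measure0// bnd_simp -leNgt ltW.
- move=> k; apply: le_lt_trans (ltry 1); apply: probability_le1;
  exact: measurable_itv.
Qed.

(** * The uniform probability on the unit interval *)

Section unit_interval.
Context (R : realType).

Let idR : measurableTypeR R -> R := idfun.
#[local] HB.instance Definition _ :=
  @isMeasurableFun.Build _ _ _ _ idR (@measurable_id _ _ setT).

(* The library puts the uniform distribution on [measurableTypeR R], whose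
   display differs from the one of the canonical structure of [R]. *)
Definition U01 : probability R R :=
  distribution (uniform_prob (@ltr01 R) : probability (measurableTypeR R) R)
    idR.

Lemma U01E A : U01 A = uniform_prob (@ltr01 R) A.
Proof. by []. Qed.

Lemma U01_itvNyc u : 0 <= u <= 1 -> U01 `]-oo, u]%classic = u%:E.
Proof.
move=> /andP[u0 u1]; rewrite U01E /uniform_prob integral_uniform_pdf.
rewrite (_ : _ `&` _ = `[0, u]%classic); last first.
  apply/seteqP; split => x /=; rewrite !in_itv/=;
    first by move=> [-> /andP[->]].
  by move=> /andP[-> xu]; rewrite xu (le_trans xu).
rewrite (eq_integral (cst 1%E)); last first.
  move=> x; rewrite inE/= in_itv/= /uniform_pdf => /andP[-> xu].
  by rewrite (le_trans xu)// subr0 invr1.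
rewrite integral_cst//= mul1e lebesgue_measure_itv/= lte_fin.
by case: ltP => [_|]; rewrite ?oppr0 ?adde0// => /(conj u0)/andP/le_anti <-.
Qed.

Lemma U01_set1 u : U01 [set u] = 0%E.
Proof.
rewrite U01E; have /null_content_dominatesP :=
  dominates_uniform_prob (@ltr01 R).
by apply=> //; exact: lebesgue_measure_set1.
Qed.

End unit_interval.

(** * Supports and monotone rearrangements *)

(** A countable base of the topology of the line, which turns unions of open sets into countable
    unions. *)
Definition rat_itv (R : realType) (q : rat * rat) : set R :=
  `]ratr q.1, ratr q.2[%classic.

Lemma ex_rat_itv_ball (R : realType) (z e : R) : 0 < e ->
  exists q, @rat_itv R q z /\ @rat_itv R q `<=` ball z e.
Proof.
move=> e0; have [p] : exists p, ratr p \in `]z - e, z[.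
  by apply: rat_in_itvoo; rewrite ltrBlDr ltrDl.
have [q] : exists p, ratr p \in `]z, z + e[.
  by apply: rat_in_itvoo; rewrite ltrDl.
rewrite !in_itv/= => /andP[zq qe] /andP[ep pz]; exists (p, q).
split; first by rewrite /rat_itv/= in_itv/= pz zq.
by rewrite ball_itv; apply: subset_itv; rewrite bnd_simp ltW.
Qed.

(** Each point off the support has a null open neighbourhood, hence a null rational interval around
    it, and there are countably many such intervals. *)
Lemma negligible_SuppC (R : realType) (m : probability R R) :
  m.-negligible (~` Supp m).
Proof.
(* Enumerates the null rational intervals; integers that code no such interval contribute the empty
   set. *)
pose F n := if unpickle n is Some q then
  if `[< m (@rat_itv R q) = 0%E >] then @rat_itv R q else set0 else set0.
apply: (@negligibleS _ _ _ _ (\bigcup_n F n)); last first.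
  apply: negligible_bigcup => n; rewrite /F; case: unpickle => [q|]; last first.
    exact: negligible_set0.
  case: asboolP => [q0|_]; last exact: negligible_set0.
  by apply/negligibleP => //; exact: measurable_itv.
move=> x /existsNP[U /not_implyP[oU /not_implyP[Ux mU]]].
have /nbhs_ballP[e /= e0 xeU] : nbhs x U by exact: open_nbhs_nbhs.
have [q [qx qe]] := ex_rat_itv_ball x e0.
have := pickleK q; move: (pickle _) => n nE; exists n => //.
rewrite /F nE asboolT//; apply/eqP; rewrite -measure_le0.
apply: (@le_trans _ _ (m U)); last by rewrite leNgt; apply/negP.
apply: le_measure; rewrite ?inE; first exact: measurable_itv.
  exact: open_measurable.
exact: subset_trans xeU.
Qed.

Lemma Supp_sub_null (R : realType) (m : probability R R) (S : set R) :
  measurable S -> Supp m `<=` S -> m (~` S) = 0%E.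
Proof.
move=> mS SuppS; apply/negligibleP; first exact: measurableC.
by apply: negligibleS (negligible_SuppC m) => x /= Sx /SuppS.
Qed.

Lemma Supp_nonempty (R : realType) (m : probability R R) : Supp m !=set0.
Proof.
apply/set0P/eqP => S0.
have := @Supp_sub_null _ m set0 measurable0; rewrite S0 setC0 probability_setT.
by move=> /(_ (@subset_refl _ _))/eqP; rewrite onee_eq0.
Qed.

Lemma Supp_closed (X : topologicalType) (R : realType) (m : set X -> \bar R) :
  closed (Supp m).
Proof.
move=> x cx U oU Ux; have [y [+ Uy]] := cx U (open_nbhs_nbhs (conj oU Ux)).
exact.
Qed.

Lemma Supp_sub_closed (X : topologicalType) (R : realType) (m : set X -> \bar R)
  (S : set X) : closed S -> m (~` S) = 0%E -> Supp m `<=` S.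
Proof.
move=> cS mS x Sx; apply: contrapT => nSx.
by have := Sx _ (closed_openC cS) nSx; rewrite mS ltxx.
Qed.

Lemma compact_Supp (R : realType) (m : probability R R) (M : R) :
  m (~` `[- M, M]%classic) = 0%E -> compact (Supp m).
Proof.
move=> mM; have cM := @segment_compact R (- M) M.
apply: (subclosed_compact (@Supp_closed _ _ _) cM).
by apply: Supp_sub_closed mM; exact: interval_closed.
Qed.

Section laws.
Context (R : realType).
Implicit Types g h : R -> R.

(** The null level [1/2] is put in the upper half, which keeps the function nondecreasing on the
    whole line. *)
Definition sg (u : R) : R := if u < 2^-1 then -1 else 1.

Lemma sg_homo : {homo sg : u w / u <= w}.
Proof.
move=> u w uw; rewrite /sg; case: ltP => u2; case: ltP => w2 //; lra.
Qed.

Lemma normr_sg u : `|sg u| = 1.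
Proof. by rewrite /sg; case: ltP; rewrite ?normrN normr1. Qed.

Lemma homo_measurable g : {homo g : u w / u <= w} -> measurable_fun setT g.
Proof. by move=> gnd; exact: nondecreasing_measurable. Qed.

Lemma measurable_sg : measurable_fun setT sg.
Proof. by apply: homo_measurable; exact: sg_homo. Qed.

Lemma homo_flow g t : {homo g : u w / u <= w} -> 0 <= t ->
  {homo (fun u => g u + t * sg u) : u w / u <= w}.
Proof.
move=> gnd t0 u w uw; rewrite lerD ?gnd// ler_wpM2l//; exact: sg_homo.
Qed.

Lemma measurable_flow g t : measurable_fun setT g ->
  measurable_fun setT (fun u => g u + t * sg u).
Proof.
by move=> mg; apply: measurable_funD => //; apply: measurable_funM => //;
  exact: measurable_sg.
Qed.

Lemma U01_ae_neq (u : R) : {ae U01 R, forall w, w != u}.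
Proof.
exists [set u]; split => //; first exact: U01_set1.
by move=> w /= /negP; rewrite negbK => /eqP.
Qed.

Lemma U01_itvNyo (u : R) : 0 <= u <= 1 -> U01 R `]-oo, u[%classic = u%:E.
Proof.
move=> u01; rewrite -(U01_itvNyc u01); apply: ae_eq_measure => //.
apply: filterS (U01_ae_neq u) => w /= wu; rewrite !in_itv/=; split=> [/ltW//|].
by rewrite lt_neqAle wu.
Qed.

Lemma half01 : 0 <= (2^-1 : R) <= 1.
Proof. lra. Qed.

(** Laws are produced existentially and known only through [eq_meas], in the form in which given
    measures are related to their rearrangements. *)
Lemma ex_law d (X : measurableType d) (f : R -> X) : measurable_fun setT f ->
  exists m : probability X R, eq_meas m (pushforward (U01 R) f).
Proof.
move=> mf; pose f' := HB.pack_for {mfun R >-> X} f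
  (isMeasurableFun.Build _ _ _ _ _ mf).
by exists (distribution (U01 R) f').
Qed.

Lemma ae_eq_law d (X : measurableType d) (f1 f2 : R -> X) :
  measurable_fun setT f1 -> measurable_fun setT f2 ->
  {ae U01 R, forall u, f1 u = f2 u} ->
  eq_meas (pushforward (U01 R) f1) (pushforward (U01 R) f2).
Proof.
move=> mf1 mf2 f12 A mA; rewrite /pushforward.
apply: (@ae_eq_measure _ _ _ (U01 R)).
- by rewrite -[_ @^-1` _]setTI; exact: mf1.
- by rewrite -[_ @^-1` _]setTI; exact: mf2.
- by apply: filterS f12 => u /= ->.
Qed.

Lemma bounded_law_Supp (m : probability R R) (f : R -> R) (M : R) :
  eq_meas m (pushforward (U01 R) f) -> (forall u, `|f u| <= M) ->
  Supp m `<=` `[- M, M]%classic /\ compact (Supp m).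
Proof.
move=> mf fM.
have m0 : m (~` `[- M, M]%classic) = 0%E.
  rewrite mf; last by apply: measurableC; exact: measurable_itv.
  rewrite /pushforward (_ : _ @^-1` _ = set0) ?measure0//.
  by apply/seteqP; split => // u /=; rewrite in_itv/= -ler_norml fM.
split; last exact: compact_Supp m0.
by apply: Supp_sub_closed m0; exact: interval_closed.
Qed.

Lemma Pc_bounded (mu : Pc R) : exists2 M : R,
  0 < M & Supp mu `<=` ball (0 : R) M.
Proof.
have [M [_ HM]] := compact_bounded (@Pc_compact _ mu).
exists (`|M| + 2) => // x /(HM (`|M| + 1)).
rewrite -ball_normE /= sub0r normrN => xM.
apply: le_lt_trans (xM _) _; last lra.
by have := ler_norm M; lra.
Qed.

(** As a random variable, the identity has the distribution function of the underlying measure, so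
    that the results on [cdf] apply to the measure itself. *)
Let idR : R -> R := idfun.
#[local] HB.instance Definition _ :=
  @isMeasurableFun.Build _ _ _ _ idR (@measurable_id _ _ setT).

Lemma le_measure_itvNyc (mu : probability R R) x y :
  x <= y -> (mu `]-oo, x]%classic <= mu `]-oo, y]%classic)%E.
Proof. by move=> xy; apply: (cdf_nondecreasing (idR : {RV mu >-> R})). Qed.

Lemma measure_itvNyc_right_lim (mu : probability R R) (x u : R) :
  (\forall y \near x^'+, (u%:E <= mu `]-oo, y]%classic)%E) ->
  (u%:E <= mu `]-oo, x]%classic)%E.
Proof.
move=> H.
by apply: (cvge_to_ge (@cdf_right_continuous _ _ _ mu (idR : {RV mu >-> R}) x)).
Qed.

(* The quantile function, truncated to [-M, M] so as to be finite and monotone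
   on the whole line. *)
Lemma ex_rearrangement (mu : probability R R) (M : R) :
  0 < M -> Supp mu `<=` ball (0 : R) M ->
  exists g, [/\ {homo g : u w / u <= w}, forall u, `|g u| <= M &
    eq_meas mu (pushforward (U01 R) g)].
Proof.
move=> M0 muM.
have mu0 : mu (~` `[- M, M]%classic) = 0%E.
  apply: Supp_sub_null => //; apply: subset_trans muM _.
  by rewrite ball_itv; apply: subset_itv; rewrite bnd_simp ?sub0r ?add0r.
(* The points where the distribution function is still below [u]. Adding [- M] keeps the set
   nonempty and the bound [x <= M] keeps it bounded, for levels [u] outside the unit interval as
   well. *)
pose E u := [set x | x = - M \/ (x <= M /\ (mu `]-oo, x]%classic < u%:E)%E)].
have E0 u : E u (- M) by left.
have EM u : ubound (E u) M by move=> x [->|[]//]; lra.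
have Es u : has_sup (E u) by split; [exists (- M)|exists M].
pose g u := sup (E u).
have gM u : g u <= M by apply: sup_le_ub => //; exists (- M).
have gNM u : - M <= g u by apply: ub_le_sup => //; exists M.
have gnd : {homo g : u w / u <= w}.
  move=> u w uw; apply: le_sup => [x Ex||]; [|by exists (- M)|exact: Es].
  apply/downP; exists x => //.
  case: Ex => [->|[xM xu]]; [by left|right; split=> //].
  by apply: lt_le_trans xu _; rewrite lee_fin.
have [m mg] := ex_law (homo_measurable gnd).
exists g; split => //; first by move=> u; rewrite ler_norml gNM gM.
suff mum : eq_meas mu m by move=> A mA; rewrite mum// mg.
apply: probability_cdf_inj => x; rewrite mg; last exact: measurable_itv.
rewrite /pushforward.
have [xM|Mx] := ltP x (- M).
  rewrite (_ : g @^-1` _ = set0).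
    rewrite measure0; apply/eqP; rewrite -measure_le0 -mu0.
    apply: le_measure; rewrite ?inE;
      [exact: measurable_itv|by apply: measurableC; exact: measurable_itv|].
    by move=> z /=; rewrite !in_itv/= => zx; apply/negP;
      rewrite negb_and -ltNge; rewrite (le_lt_trans zx).
  by apply/seteqP; split => // u; rewrite /= in_itv/= => /(le_trans (gNM u));
    rewrite leNgt xM.
have [Mx'|xM] := leP M x.
  rewrite (_ : g @^-1` _ = setT); last first.
    by apply/seteqP; split => // u _; rewrite /= in_itv/= (le_trans (gM u)).
  rewrite probability_setT -(probability_setT mu); apply: ae_eq_measure => //.
  exists (~` `[- M, M]%classic); split => //.
    by apply: measurableC; exact: measurable_itv.
  apply: subsetC => z /=; rewrite !in_itv/= => /andP[_ zM].
  by rewrite (le_trans zM).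
have [f fE] : exists f, mu `]-oo, x]%classic = f%:E.
  by exists (fine (mu `]-oo, x]%classic)); rewrite fineK// fin_num_measure.
rewrite fE -U01_itvNyc; last first.
  rewrite -!lee_fin -fE measure_ge0 probability_le1//.
(* Galois connection with the distribution function [F] of [mu]: [u <= F x] iff [g u <= x]. One
   direction is monotonicity of [F]; the other is its right continuity, where [x < M] lets points
   slightly above [x] be candidates for [E u]. *)
congr (U01 R _); apply/seteqP; split => u;
  rewrite /= !in_itv/= -[u <= f]lee_fin -fE.
  move=> ux; apply: sup_le_ub; first by exists (- M).
  move=> z [->//|[_ zu]]; rewrite leNgt;
    apply/negP => /ltW/(le_measure_itvNyc mu) xz.
  by have := lt_le_trans (le_lt_trans xz zu) ux; rewrite ltxx.
move=> gx; apply: measure_itvNyc_right_lim; near=> y.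
rewrite leNgt; apply/negP => yu.
have : y <= g u by apply: ub_le_sup; [exists M|right; split => //; apply/ltW;
  near: y; exact: nbhs_right_lt].
move=> /le_trans/(_ gx); rewrite leNgt => /negP; apply.
by near: y; exact: nbhs_right_gt.
Unshelve. all: by end_near. Qed.

End laws.

(** * The vector field in terms of rearrangements *)

Section otimes_split.
Context (R : realType).

(** Multiplying by the mass of the atom clears the denominator. If there is no atom, the two
    coefficients are nonnegative with sum zero, so both sides vanish and the identity covers that
    case too. *)
Lemma nu_split_atom (mu : probability R R) (A : set R) :
  (nu_split mu (Bpt mu) A * mu [set Bpt mu] =
   (eta_of mu)%:E * \d_(1 : R)%R A +
   ((2^-1)%:E - mu `]-oo, Bpt mu[%classic) * \d_(-1 : R)%R A)%E.
Proof.
have [f fE] : exists f, mu `]-oo, Bpt mu[%classic = f%:E.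
  by exists (fine (mu `]-oo, Bpt mu[%classic)); rewrite fineK// fin_num_measure.
have [b bE] : exists b, mu [set Bpt mu] = b%:E.
  by exists (fine (mu [set Bpt mu])); rewrite fineK// fin_num_measure.
have := eta_half_lt_Bpt mu; have := eta_ge0 mu; have := half_lt_Bpt_ge0 mu.
rewrite /nu_split ltxx fE bE -EFinB /= lte_fin.
set e := eta_of mu; set h := 2^-1 - _ => h0 e0 eh.
case: ltP => [b0|b0].
  by rewrite muleAC -EFinM mulVf ?gt_eqF// mul1r.
have -> : b = 0 by lra.
have -> : e = 0 by lra.
have -> : h = 0 by lra.
by rewrite mule0 !mul0e adde0.
Qed.

(** The kernel is integrated separately to the left of the median, to its right, and at the median,
    where [nu_split_atom] removes the division. *)
Lemma V_splitE (mu : probability R R) (A : set (R * R)) : measurable A ->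
  (V_split mu A =
   mu [set x : R | (x < Bpt mu)%R /\ A (x, -1 : R)%R] +
   mu [set x : R | (Bpt mu < x)%R /\ A (x, 1 : R)%R] +
   ((eta_of mu)%:E * \d_(Bpt mu, 1 : R)%R A +
   ((2^-1)%:E - mu `]-oo, Bpt mu[%classic) * \d_(Bpt mu, -1 : R)%R A))%E.
Proof.
move=> mA; set B := Bpt mu.
have mS c : measurable [set x | A (x, c)].
  rewrite -[X in measurable X]setTI;
    apply: (pair2_measurable c measurableT) => //.
have mS1 : measurable [set x | x < B /\ A (x, -1)].
  rewrite (_ : mkset _ = `]-oo, B[%classic `&` [set x | A (x, -1)]).
    exact: measurableI.
  by apply/seteqP; split => x /=; rewrite in_itv.
have mS2 : measurable [set x | B < x /\ A (x, 1)].
  rewrite (_ : mkset _ = `]B, +oo[%classic `&` [set x | A (x, 1)]).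
    exact: measurableI.
  by apply/seteqP; split => x /=; rewrite in_itv/= andbT.
rewrite /V_split /=  /otimes.
have -> : (fun x => \int[nu_kernel mu x]_v (\1_A (x, v))%:E)%E =
  (fun x => (\1_[set x | (x < B)%R /\ A (x, -1)%R] x)%:E +
   (\1_[set x | (B < x)%R /\ A (x, 1)%R] x)%:E +
   nu_split mu B (xsection A B) * (\1_[set B] x)%:E)%E.
  apply/funext => x.
  transitivity (nu_split mu x (xsection A x)).
    rewrite -[X in nu_split _ _ X]setIT -[RHS](@integral_indic _ _ _ (nu_kernel
      mu x))//; last exact: measurable_xsection.
    by apply: eq_integral => v _; rewrite !indicE mem_xsection.
  have sE c : (c \in xsection A x) = `[< A (x, c) >] by rewrite mem_xsection.
  have inE' (P : R -> Prop) : (x \in [set y | P y]) = `[< P x >] by [].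
  have trE P : `[< true /\ P >] = `[< P >] by apply: asbool_equiv_eq;
    split=> // -[].
  have faE P : `[< false /\ P >] = false by rewrite asboolF// => -[].
  rewrite !indicE !inE'; case: (ltgtP x B) => xB /=; rewrite ?trE ?faE.
  - rewrite [nu_split mu x _]/nu_split xB diracE sE (asboolF (P := x = B));
    last lra.
    by rewrite mule0 !adde0.
  - rewrite [nu_split mu x _]/nu_split xB ltNge (ltW xB)/= diracE sE.
    by rewrite (asboolF (P := x = B)) ?mule0 ?adde0 ?add0e//; lra.
  - by rewrite xB asboolT// mule1 !add0e.
have m1 (S : set R) : measurable S -> measurable_fun setT (fun x : R =>
  (\1_S x)%:E : \bar R).
  by move=> mS'; apply/measurable_EFinP; exact: measurable_indic.
rewrite ge0_integralD//=; last first.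
- by apply: measurable_funeM; apply: m1.
- by move=> x _; rewrite mule_ge0// lee_fin.
- by apply: emeasurable_funD; apply: m1.
- by move=> x _; rewrite adde_ge0// lee_fin.
rewrite ge0_integralD//; [|exact: m1|exact: m1].
rewrite ge0_integralZl//; [|exact: m1].
rewrite !integral_indic//= !setIT nu_split_atom.
by congr (_ + (_ * _ + _ * _))%E; rewrite !diracE mem_xsection.
Qed.

End otimes_split.

Section median_rearrangement.
Context (R : realType) (mu : probability R R) (g : R -> R).
Hypothesis gnd : {homo g : u w / u <= w}.
Hypothesis mug : eq_meas mu (pushforward (U01 R) g).

Let B := Bpt mu.
Let mg := homo_measurable gnd.

Let mpre (A : set R) : measurable A -> measurable (g @^-1` A).
Proof. by move=> mA; rewrite -[_ @^-1` _]setTI; exact: mg. Qed.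

(** If [g u] exceeded the median, all levels with [g] at most [B] would lie below [u], and []-oo,
    B]] would have mass less than one half. *)
Lemma rearr_le_Bpt u : u < 2^-1 -> g u <= B.
Proof.
move=> u2; rewrite leNgt; apply/negP => Bg.
have := half_le_Bpt mu; rewrite mug// leNgt => /negP; apply.
(* The level [u] may be negative; truncating it at [0] brings it into the range where the mass of
   the half-line equals its endpoint. *)
apply: (@le_lt_trans _ _ (U01 R `]-oo, Num.max u 0]%classic)).
  rewrite /pushforward; apply: le_measure; rewrite ?inE//; first exact: mpre.
  move=> w /=; rewrite !in_itv/= => gw; rewrite le_max; apply/orP; left.
  rewrite leNgt; apply/negP => /ltW/gnd; rewrite leNgt => /negP; apply.
  exact: le_lt_trans Bg.
have := half01 R; rewrite U01_itvNyc ?lte_fin ?gt_max ?le_max ?ge_max ?lexx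
  ?orbT/=; lra.
Qed.

Lemma rearr_ge_Bpt u : 2^-1 < u -> B <= g u.
Proof.
move=> u2; rewrite leNgt; apply/negP => Bg.
have := lt_Bpt_le_half mu; rewrite mug// leNgt => /negP; apply.
apply: (@lt_le_trans _ _ (U01 R `]-oo, Num.min u 1]%classic)).
  by have := half01 R; rewrite U01_itvNyc ?lte_fin ?lt_min ?le_min ?ge_min
    ?lexx ?orbT/=; lra.
rewrite /pushforward; apply: le_measure; rewrite ?inE//; first exact: mpre.
move=> w /=; rewrite !in_itv/= le_min => /andP[/gnd wu _].
exact: le_lt_trans Bg.
Qed.

Let mlt : measurable (g @^-1` `]-oo, B[%classic).
Proof. by apply: mpre; exact: measurable_itv. Qed.

Let mgt : measurable (g @^-1` `]B, +oo[%classic).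
Proof. by apply: mpre; exact: measurable_itv. Qed.

Let meq : measurable (g @^-1` [set B]).
Proof. exact: mpre. Qed.

(** Up to the level [1/2], the levels below one half are those with [g u < B] together with the part
    of the atom considered here, hence the difference of masses. *)
Let U01_left :
  U01 R (g @^-1` [set B] `&` `]-oo, 2^-1[%classic) =
  ((2^-1)%:E - mu `]-oo, B[%classic)%E.
Proof.
rewrite -(U01_itvNyo (half01 R)) mug ?measurable_itv// /pushforward.
rewrite [X in (X - _)%E](_ : _ = U01 R (g @^-1` `]-oo, B[%classic `|`
    (g @^-1` [set B] `&` `]-oo, 2^-1[%classic))); last first.
  apply: ae_eq_measure => //; first by apply: measurableU => //;
    exact: measurableI.
  apply: filterS (U01_ae_neq 2^-1) => u u2 /=; rewrite !in_itv/=; split.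
    move=> uh; have := rearr_le_Bpt uh; rewrite le_eqVlt => /orP[/eqP|]; tauto.
  move=> [gB|[//]]; rewrite lt_neqAle u2/= leNgt; apply/negP => /rearr_ge_Bpt.
  by rewrite leNgt gB.
rewrite measureU//; [|exact: measurableI|].
  by rewrite addeAC subee ?add0e// fin_num_measure.
by apply/seteqP; split => // u [/=]; rewrite in_itv/= => gB [gB' _];
  rewrite gB' ltxx in gB.
Qed.

(** Up to the level [1/2], the levels with [g u <= B] are those below one half together with the
    part of the atom considered here. *)
Let U01_right :
  U01 R (g @^-1` [set B] `&` `[2^-1, +oo[%classic) = (eta_of mu)%:E.
Proof.
rewrite /eta_of EFinB fineK ?fin_num_measure//.
rewrite -(U01_itvNyo (half01 R)) mug ?measurable_itv// /pushforward.
rewrite [X in (X - _)%E](_ : _ = U01 R (`]-oo, 2^-1[%classic `|`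
    (g @^-1` [set B] `&` `[2^-1, +oo[%classic))); last first.
  apply: ae_eq_measure => //.
  - by apply: mpre; exact: measurable_itv.
  - by apply: measurableU => //; exact: measurableI.
  apply: filterS (U01_ae_neq 2^-1) => u u2 /=; rewrite !in_itv/= andbT; split.
    case: (ltP u 2^-1) => uh gB; [by left|right; split=> //].
    apply/eqP; rewrite eq_le gB/=; apply: rearr_ge_Bpt.
    by rewrite lt_neqAle eq_sym u2.
  by move=> [/rearr_le_Bpt|[-> _]].
rewrite measureU//; [|exact: measurableI|].
  by rewrite addeAC subee ?add0e// fin_num_measure.
by apply/seteqP; split => // u [/=]; rewrite !in_itv/= andbT; lra.
Qed.

(* Up to the null level [1/2], [g u < B] forces [u < 1/2] and [B < g u] forces
   [1/2 < u], so that only the atom at [B] is split. *)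
Lemma V_split_rearr :
  eq_meas (V_split mu) (pushforward (U01 R) (fun u => (g u, sg u))).
Proof.
move=> A mA; rewrite V_splitE// -/B /pushforward.
set D := _ @^-1` A.
have mD : measurable D.
  rewrite -[D]setTI; apply: measurable_fun_pair => //; exact: measurable_sg.
have mS c : measurable [set x | A (x, c)].
  by rewrite -[X in measurable X]setTI; apply: (pair2_measurable c measurableT).
(* Four pieces: the first flag tells that [g u] differs from [B], the second that the mass moves to
   the left. They match the four terms of [V_splitE]. *)
pose Z (b : bool * bool) : set R :=
  if b.1 then (if b.2 then g @^-1` `]-oo, B[%classic
               else g @^-1` `]B, +oo[%classic)
  else g @^-1` [set B] `&`
       (if b.2 then `]-oo, 2^-1[%classic else `[2^-1, +oo[%classic).
pose k u : bool * bool := if g u < B then (true, true) else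
  if B < g u then (true, false) else (false, u < 2^-1).
have Zk b u : Z b u <-> b = k u.
  rewrite /Z /k; case: b => [[] []] /=; rewrite !in_itv/= ?andbT;
  case: (ltgtP (g u) B) => gB //=; case: ltP => u2 //=; split=> //;
  by [case|move=> [gB' _]; rewrite gB' ltxx in gB].
rewrite [RHS](@measure_split_fin _ _ _ (U01 R) _ Z D) //; last 3 first.
- by move=> [[] []]; rewrite /Z//=; exact: measurableI.
- by move=> u; exists (k u); apply/Zk.
- by move=> i j u /Zk -> /Zk ->.
have sum4 (f : bool * bool -> \bar R) : (\sum_(b : bool * bool) f b =
    f (true, true) + f (true, false) + (f (false, false) + f (false, true)))%E.
  rewrite (eq_bigr (fun b => f (b.1, b.2))); last by case.
  by rewrite -(pair_bigA _ (fun a b => f (a, b)))/= !big_bool/=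
    [X in (_ + X)%E]addeC.
have mS1 : measurable [set x | x < B /\ A (x, -1)].
  rewrite (_ : mkset _ = `]-oo, B[%classic `&` [set x | A (x, -1)]).
    exact: measurableI.
  by apply/seteqP; split => x /=; rewrite in_itv.
have mS2 : measurable [set x | B < x /\ A (x, 1)].
  rewrite (_ : mkset _ = `]B, +oo[%classic `&` [set x | A (x, 1)]).
    exact: measurableI.
  by apply/seteqP; split => x /=; rewrite in_itv/= andbT.
rewrite sum4 mug// mug// /pushforward; congr (_ + _ + _)%E.
- rewrite /Z/=; apply: ae_eq_measure; [exact: mpre|exact: measurableI|].
  apply: filterS (U01_ae_neq 2^-1) => u u2; rewrite /D /sg/= in_itv/=.
  case: (ltP u) => [_|uh]; first exact: iff_refl.
  split=> -[gB _];
  have /rearr_ge_Bpt : 2^-1 < u by [rewrite lt_neqAle eq_sym u2];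
    by rewrite leNgt gB.
- rewrite /Z/=; apply: ae_eq_measure; [exact: mpre|exact: measurableI|].
  apply: filterS (U01_ae_neq 2^-1) => u u2; rewrite /D /sg/= in_itv/= andbT.
  case: (ltP u) => [uh|_]; last exact: iff_refl.
  split=> -[gB _];
  have := rearr_le_Bpt uh; by rewrite leNgt gB.
(* On the two pieces lying over the atom both position and velocity are constant, so each
   contributes a Dirac mass. *)
have U01_dirac S c : (forall u, S u -> g u = B /\ sg u = c) ->
    U01 R (S `&` D) = (U01 R S * \d_(B, c) A)%E.
  move=> Sc; rewrite diracE; have [BA|BA] := boolP ((B, c) \in A).
    rewrite mule1 (_ : _ `&` _ = S)//; apply/seteqP; split => [u []//|u Su].
    by split => //; have [gu su] := Sc u Su; rewrite /D/= gu su; exact: set_mem.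
  rewrite mule0 (_ : _ `&` _ = set0) ?measure0//; apply/seteqP;
    split => // u [Su].
  have [gu su] := Sc u Su; rewrite /D/= gu su => /mem_set; apply/negP => //.
congr (_ + _)%E.
- rewrite -U01_right; apply/esym/U01_dirac => u [->] /=.
  by rewrite /sg in_itv/= andbT ltNge => ->.
- rewrite -U01_left; apply/esym/U01_dirac => u [->] /=.
  by rewrite /sg in_itv/= => ->.
Qed.

End median_rearrangement.

(** * Optimal transport on the line *)

Section law_integrals.
Context d (X : measurableType d) (R : realType).
Variables (m : {measure set X -> \bar R}) (f : R -> X).
Hypotheses (mf : measurable_fun setT f) (lf : eq_meas m (pushforward (U01 R)
  f)).

Let f' : {mfun R >-> X} :=
  HB.pack_for {mfun R >-> X} f (isMeasurableFun.Build _ _ _ _ _ mf).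

Lemma law_ge0_integral (F : X -> \bar R) : measurable_fun setT F ->
  (forall x, 0 <= F x)%E -> (\int[m]_x F x = \int[U01 R]_u F (f u))%E.
Proof.
move=> mF F0; transitivity (\int[distribution (U01 R) f']_x F x)%E.
  by apply: eq_measure_integral => A mA _; exact: lf.
by rewrite ge0_integral_distribution.
Qed.

Lemma law_integrable (F : X -> \bar R) : measurable_fun setT F ->
  (U01 R).-integrable setT (F \o f) -> m.-integrable setT F.
Proof.
move=> mF /integrableP[_ intF]; apply/integrableP; split => //.
by rewrite law_ge0_integral//; exact: measurableT_comp.
Qed.

Lemma law_Rintegral (F : X -> R) : measurable_fun setT F ->
  (U01 R).-integrable setT (EFin \o (F \o f)) ->
  (\int[m]_x F x = \int[U01 R]_u F (f u))%R.
Proof.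
move=> mF intF; rewrite /Rintegral; congr fine.
transitivity (\int[distribution (U01 R) f']_x (F x)%:E)%E.
  by apply: eq_measure_integral => A mA _; exact: lf.
by rewrite integral_distribution//; exact/measurable_EFinP.
Qed.

End law_integrals.

Section measurable_comparison.
Context d (T : measurableType d) (R : realType) (X Y : T -> R).
Hypotheses (mX : measurable_fun setT X) (mY : measurable_fun setT Y).

Lemma measurable_set_ler : measurable [set t | X t <= Y t].
Proof.
rewrite -[X in measurable X]setTI.
exact: (measurable_fun_ler mX mY measurableT (Y := [set true])).
Qed.

Lemma measurable_set_ltr : measurable [set t | X t < Y t].
Proof.
rewrite -[X in measurable X]setTI.
exact: (measurable_fun_ltr mX mY measurableT (Y := [set true])).
Qed.

End measurable_comparison.

Lemma measurable_between d (T : measurableType d) (R : realType)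
    (X Y Z : T -> R) : measurable_fun setT X -> measurable_fun setT Y ->
  measurable_fun setT Z -> measurable [set t | X t <= Z t /\ Z t < Y t].
Proof.
by move=> mX mY mZ; apply: measurableI;
  [exact: measurable_set_ler|exact: measurable_set_ltr].
Qed.

Section transport.
Context (R : realType).
Local Open Scope ereal_scope.

(* Tonelli applied to [|x - y|], the length of the set of the [z] separating
   [x] from [y]. *)
Lemma transport_costE (tau : probability (R * R)%type R) :
  let f (z : measurableTypeR R) :=
    tau [set p | (p.1 <= z)%R /\ (z < p.2)%R] +
    tau [set p | (p.2 <= z)%R /\ (z < p.1)%R] in
  measurable_fun setT f /\ transport_cost tau = \int[lebesgue_measure]_z f z.
Proof.
pose T := ((R * R) * measurableTypeR R)%type.
pose A : set T :=
  [set q | ((q.1.1 <= q.2)%R /\ (q.2 < q.1.2)%R) \/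
           ((q.1.2 <= q.2)%R /\ (q.2 < q.1.1)%R)].
have m11 : measurable_fun setT (fun q : T => q.1.1).
  exact: measurableT_comp measurable_fst measurable_fst.
have m12 : measurable_fun setT (fun q : T => q.1.2).
  exact: measurableT_comp measurable_snd measurable_fst.
have m2 : measurable_fun setT (fun q : T => q.2 : R) by exact: measurable_snd.
have mA : measurable A.
  by apply: measurableU; exact: (measurable_between _ _ m2).
have yA z : tau (ysection A z) = tau [set p | (p.1 <= z)%R /\ (z < p.2)%R] +
    tau [set p | (p.2 <= z)%R /\ (z < p.1)%R].
  rewrite -measureU; [|exact: measurable_between|exact: measurable_between|].
    by congr (tau _); apply/seteqP; split => p; rewrite /ysection/= inE.
  by apply/seteqP; split => // p [[/= p1 p2] [p3 p4]]; lra.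
move=> f; have fE : f = tau \o ysection A by apply/funext => z /=; rewrite yA.
split; first by rewrite fE; exact: measurable_fun_ysection.
rewrite fE.
have := indic_fubini_tonelli tau (@lebesgue_measure R) mA.
rewrite indic_fubini_tonelli_FE// indic_fubini_tonelli_GE// => <-.
apply: eq_integral => -[x y] _ /=.
have [xy|yx] := leP x y.
  rewrite (_ : xsection _ _ = `[x, y[%classic).
    rewrite lebesgue_measure_itv/= lte_fin ler0_norm ?subr_le0// opprB.
    by case: ltgtP xy => // ->; rewrite subrr.
  apply/seteqP; split => z; rewrite /xsection/= inE/A/= in_itv/=.
    by move=> [[-> ->]//|[]]; lra.
  by move=> /andP[]; left.
rewrite (_ : xsection _ _ = `[y, x[%classic).
  by rewrite lebesgue_measure_itv/= lte_fin yx gtr0_norm ?subr_gt0.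
apply/seteqP; split => z; rewrite /xsection/= inE/A/= in_itv/=.
  by move=> [[]|[-> ->]//]; lra.
by move=> /andP[]; right.
Qed.

(** Any pair [X], [Y] satisfies that [{Y <= z}] is covered by [{X <= z}] and [{Y <= z < X}], so the
    separating mass is at least the difference of the two distribution functions at [z]. Nested
    sublevel sets attain this bound. *)
Lemma nested_separation d (T : measurableType d) (m : probability T R)
    (X Y : T -> R) (g h : R -> R) (z : R) :
  measurable_fun setT X -> measurable_fun setT Y ->
  measurable_fun setT g -> measurable_fun setT h ->
  m [set t | (X t <= z)%R] = U01 R [set u | (g u <= z)%R] ->
  m [set t | (Y t <= z)%R] = U01 R [set u | (h u <= z)%R] ->
  (forall u, g u <= z -> h u <= z)%R ->
  U01 R [set u | (g u <= z)%R /\ (z < h u)%R] +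
  U01 R [set u | (h u <= z)%R /\ (z < g u)%R] <=
  m [set t | (X t <= z)%R /\ (z < Y t)%R] +
  m [set t | (Y t <= z)%R /\ (z < X t)%R].
Proof.
move=> mX mY mg mh Xg Yh gh.
have mle (f : R -> R) : measurable_fun setT f -> measurable [set u |
  (f u <= z)%R].
  by move=> mf; exact: measurable_set_ler.
rewrite (_ : [set u | _ /\ (z < h u)%R] = set0) ?measure0 ?add0e; last first.
  by apply/seteqP; split => // u [/gh]; rewrite leNgt => /negP.
apply: le_trans (leeDr _ _) => //.
(* Adding the finite mass of [{g <= z}] to both sides replaces the difference of distribution
   functions by inequalities between sums. *)
rewrite -(leeD2rE (x := U01 R [set u | (g u <= z)%R])) ?fin_num_measure//;
  last exact: mle.
rewrite -[leLHS]measureU; [|exact: measurable_between|exact: mle|]; last first.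
  by apply/seteqP; split => // u [/= []]; lra.
apply: (@le_trans _ _ (U01 R [set u | (h u <= z)%R])).
  apply: le_measure; rewrite ?inE; [|exact: mle|by move=> u [[]|/gh]].
  by apply: measurableU; [exact: measurable_between|exact: mle].
rewrite -Yh -Xg.
apply: le_trans (measureU2 _ _ _);
  [|exact: measurable_between|exact: measurable_set_ler].
apply: le_measure; rewrite ?inE; first exact: measurable_set_ler.
  by apply: measurableU; [exact: measurable_between|exact: measurable_set_ler].
by move=> t /= Yz; case: (ltP z (X t)) => Xz; [left|right].
Qed.

Section rearranged_pair.
Variables (mu nu : set R -> \bar R) (g h : R -> R).
Hypotheses (gnd : {homo g : u w / (u <= w)%R}).
Hypotheses (hnd : {homo h : u w / (u <= w)%R}).
Hypotheses (mug : eq_meas mu (pushforward (U01 R) g)).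
Hypotheses (nuh : eq_meas nu (pushforward (U01 R) h)).

Let mg := homo_measurable gnd.
Let mh := homo_measurable hnd.
Let mgh : measurable_fun setT (fun u => (g u, h u)).
Proof. exact: measurable_fun_pair. Qed.

Lemma law_pair_couplings (tau : probability (R * R)%type R) :
  eq_meas tau (pushforward (U01 R) (fun u => (g u, h u))) ->
  couplings mu nu tau.
Proof.
by move=> taugh; split => A mA; rewrite /pushforward ?mug ?nuh// taugh//
  -[_ @^-1` _]setTI; [exact: measurable_fst|exact: measurable_snd].
Qed.

Lemma law_pair_cost (tau : probability (R * R)%type R) :
  eq_meas tau (pushforward (U01 R) (fun u => (g u, h u))) ->
  transport_cost tau = \int[U01 R]_u `|g u - h u|%:E.
Proof.
move=> taugh; rewrite /transport_cost (law_ge0_integral mgh taugh)//.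
apply/measurable_EFinP; apply: measurableT_comp => //.
exact: measurable_funB measurable_fst measurable_snd.
Qed.

(** For each [z], the sublevel sets of the nondecreasing functions [g] and [h] are initial segments,
    hence nested one way or the other. The pointwise bound of [nested_separation] is then integrated
    over [z]. *)
Lemma rearr_cost_le (tau : probability (R * R)%type R) :
  couplings mu nu tau ->
  \int[U01 R]_u `|g u - h u|%:E <= transport_cost tau.
Proof.
move=> [taug tauh]; have [rho rhogh] := ex_law mgh.
rewrite -(law_pair_cost rhogh).
have [mr ->] := transport_costE rho; have [mt ->] := transport_costE tau.
apply: ge0_le_integral => //; first by move=> z _; rewrite adde_ge0.
move=> z _.
have lr : measurable [set x : R | (x <= z)%R] by exact: measurable_set_ler.
have E1 : tau [set p | (p.1 <= z)%R] = U01 R [set u | (g u <= z)%R].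
  by have := taug _ lr; rewrite mug.
have E2 : tau [set p | (p.2 <= z)%R] = U01 R [set u | (h u <= z)%R].
  by have := tauh _ lr; rewrite nuh.
rewrite !rhogh; [|exact: measurable_between|exact: measurable_between].
rewrite /pushforward/=.
have [gh|] := pselect (forall u, g u <= z -> h u <= z)%R.
  exact: nested_separation E1 E2 gh.
move=> /existsNP[u0 /not_implyP[gu0 /negP hu0]].
rewrite addeC [leRHS]addeC; apply: nested_separation E2 E1 _ => // u hu.
apply: le_trans gu0; apply: gnd; rewrite leNgt; apply/negP => /ltW/hnd.
by move=> /le_trans/(_ hu); apply/negP.
Qed.

Lemma rearr_opt_couplings (tau : probability (R * R)%type R) :
  eq_meas tau (pushforward (U01 R) (fun u => (g u, h u))) ->
  opt_couplings mu nu tau.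
Proof.
move=> taugh; split; first exact: law_pair_couplings.
by move=> tau' /rearr_cost_le; rewrite (law_pair_cost taugh).
Qed.

Lemma W1E : W1 mu nu = \int[U01 R]_u `|g u - h u|%:E.
Proof.
apply/eqP; rewrite eq_le; apply/andP; split; last first.
  by apply: le_ereal_inf_tmp => _ [tau /rearr_cost_le ? <-].
have [rho rhogh] := ex_law mgh; apply: ereal_inf_lbound.
by exists rho; [exact: law_pair_couplings|exact: law_pair_cost].
Qed.

End rearranged_pair.

(** The coupling is admissible because its projection on the base points is the monotone coupling,
    which is optimal; the velocities coincide because both fields read them off the same level. *)
Lemma calW_split (mu nu : probability R R) (g h : R -> R) :
  {homo g : u w / (u <= w)%R} -> {homo h : u w / (u <= w)%R} ->
  eq_meas mu (pushforward (U01 R) g) -> eq_meas nu (pushforward (U01 R) h) ->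
  calW (V_split mu) (V_split nu) <= 0.
Proof.
move=> gnd hnd mug nuh.
have mg := homo_measurable gnd; have mh := homo_measurable hnd.
have msg : measurable_fun setT (@sg R) by exact: measurable_sg.
have mT : measurable_fun setT (fun u : R => ((g u, sg u), (h u, sg u))).
  by apply: measurable_fun_pair; exact: measurable_fun_pair.
have mgh : measurable_fun setT (fun u : R => (g u, h u)).
  exact: measurable_fun_pair.
have [T lT] := ex_law mT; have [tau ltau] := ex_law mgh.
have V1 : eq_meas (pushforward (V_split mu) fst) (pushforward (U01 R) g).
  move=> A mA; rewrite /pushforward (V_split_rearr gnd mug)//.
  by rewrite -[_ @^-1` _]setTI; exact: measurable_fst.
have V2 : eq_meas (pushforward (V_split nu) fst) (pushforward (U01 R) h).
  move=> A mA; rewrite /pushforward (V_split_rearr hnd nuh)//.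
  by rewrite -[_ @^-1` _]setTI; exact: measurable_fst.
apply: ge_ereal_inf; exists (\int[T]_z `|z.1.2 - z.2.2|%:E); last first.
  rewrite (law_ge0_integral mT lT)//=.
    by under eq_integral do rewrite subrr normr0; rewrite integral0.
  apply/measurable_EFinP; apply: measurableT_comp => //.
  by apply: measurable_funB;
    [exact: measurableT_comp measurable_snd measurable_fst|exact:
    measurableT_comp measurable_snd measurable_snd].
exists T => //; split.
  split=> A mA; rewrite /pushforward lT/=.
  - by rewrite (V_split_rearr gnd mug).
  - by rewrite -[_ @^-1` _]setTI; exact: measurable_fst.
  - by rewrite (V_split_rearr hnd nuh).
  - by rewrite -[_ @^-1` _]setTI; exact: measurable_snd.
exists tau; first exact: (rearr_opt_couplings gnd hnd V1 V2 ltau).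
move=> A mA; rewrite ltau// /pushforward lT//.
rewrite -[_ @^-1` _]setTI; apply: measurable_fun_pair => //.
  exact: measurableT_comp measurable_fst measurable_fst.
exact: measurableT_comp measurable_fst measurable_snd.
Qed.

End transport.

(** * The [L^1] distance of rearrangements *)

Section L1_distance.
Context (R : realType).
Implicit Types g h k : R -> R.
Local Open Scope ereal_scope.

Lemma L1_le_cst g h c : measurable_fun setT g -> measurable_fun setT h ->
  (forall u, `|g u - h u| <= c)%R -> \int[U01 R]_u `|g u - h u|%:E <= c%:E.
Proof.
move=> mg mh ghc; have c0 : (0 <= c)%R by apply: le_trans (ghc 0%R).
have m1 : measurable_fun setT (fun u => `|g u - h u|%:E).
  apply/measurable_EFinP; apply: measurableT_comp => //.
  exact: measurable_funB.
rewrite (@le_trans _ _ (\int[U01 R]_u c%:E))//.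
  by apply: ge0_le_integral => // u _; rewrite lee_fin.
by rewrite integral_cst//= probability_setT mule1.
Qed.

Lemma L1_triangle k g h : measurable_fun setT g -> measurable_fun setT h ->
  measurable_fun setT k -> \int[U01 R]_u `|g u - h u|%:E <=
  \int[U01 R]_u `|g u - k u|%:E + \int[U01 R]_u `|k u - h u|%:E.
Proof.
move=> mg mh mk.
have m1 (a b : R -> R) : measurable_fun setT a -> measurable_fun setT b ->
    measurable_fun setT (fun u => `|a u - b u|%:E).
  move=> ma mb; apply/measurable_EFinP; apply: measurableT_comp => //.
  exact: measurable_funB.
rewrite -ge0_integralD//; [|exact: m1|exact: m1].
apply: ge0_le_integral => //; [exact: m1|by apply: emeasurable_funD;
  exact: m1|].
by move=> u _; rewrite -EFinD lee_fin; exact: ler_distD.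
Qed.

Lemma L1_eq0 g h : measurable_fun setT g -> measurable_fun setT h ->
  \int[U01 R]_u `|g u - h u|%:E <= 0 -> {ae U01 R, forall u, g u = h u}.
Proof.
move=> mg mh gh0.
have mgh : measurable_fun setT (fun u => (g u - h u)%:E).
  by apply/measurable_EFinP; exact: measurable_funB.
have /(ae_eq_integral_abs _ measurableT mgh) : \int[U01 R]_u `|(g u - h u)%:E|
  = 0.
  by apply/eqP; rewrite eq_le gh0/= integral_ge0.
by apply: filterS => u /(_ I)[/eqP]; rewrite subr_eq0 => /eqP.
Qed.

(** The coupling of [mu] with itself by [(g, g)] costs nothing, while the cost of any coupling
    dominates the [L^1] distance of [g] and [h]. *)
Lemma rearr_ae_unique (mu : set R -> \bar R) g h :
  {homo g : u w / (u <= w)%R} -> {homo h : u w / (u <= w)%R} ->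
  eq_meas mu (pushforward (U01 R) g) -> eq_meas mu (pushforward (U01 R) h) ->
  {ae U01 R, forall u, g u = h u}.
Proof.
move=> gnd hnd mug muh.
have mg := homo_measurable gnd; have mh := homo_measurable hnd.
apply: L1_eq0 => //.
have [tau ltau] := ex_law (measurable_fun_pair mg mg).
have cpl := law_pair_couplings mug mug ltau.
have := rearr_cost_le gnd hnd mug muh cpl; move=> /le_trans; apply.
rewrite (law_pair_cost gnd gnd ltau); under eq_integral do rewrite subrr normr0.
by rewrite integral0.
Qed.

End L1_distance.

Lemma flow0 (R : realType) (g : R -> R) : (fun u => g u + 0 * sg u) = g.
Proof. by apply/funext => u; rewrite mul0r addr0. Qed.

(** * Lattice approximate solutions *)

Section lattice.
Context (R : realType) (N : nat).
Hypothesis N0 : (0 < N)%N.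

Let N0R : 0 < N%:R :> R. Proof. by rewrite ltr0n. Qed.
Let N20R : 0 < (N ^ 2)%:R :> R. Proof. by rewrite ltr0n expn_gt0 N0. Qed.

Lemma cell_inj (n a b : nat) (c v : R) : 0 < n%:R :> R ->
  (a%:R - c) / n%:R <= v < (a%:R - c) / n%:R + n%:R^-1 ->
  (b%:R - c) / n%:R <= v < (b%:R - c) / n%:R + n%:R^-1 -> a = b.
Proof.
move=> n0.
have E (k : nat) : (k%:R - c) / n%:R + n%:R^-1 = (k.+1%:R - c) / n%:R.
  by rewrite -[X in _ + X]mul1r -mulrDl -natr1 addrAC.
rewrite !E => /andP[a1 a2] /andP[b1 b2].
have := le_lt_trans a1 b2; have := le_lt_trans b1 a2.
rewrite !ltr_pM2r ?invr_gt0// !ltrD2r !ltr_nat !ltnS => ba ab.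
by apply/eqP; rewrite eqn_leq ab.
Qed.

Lemma xgrid_cell_inj (i j : 'I_(2 * N ^ 3).+1) (x : R) :
  xgrid R i <= x < xgrid R i + (N ^ 2)%:R^-1 ->
  xgrid R j <= x < xgrid R j + (N ^ 2)%:R^-1 -> i = j.
Proof. by move=> xi xj; apply: val_inj; exact: cell_inj N20R xi xj. Qed.

Lemma vgrid_cell_inj (i j : 'I_(2 * N ^ 2).+1) (x : R) :
  vgrid R i <= x < vgrid R i + N%:R^-1 ->
  vgrid R j <= x < vgrid R j + N%:R^-1 -> i = j.
Proof. by move=> xi xj; apply: val_inj; exact: cell_inj N0R xi xj. Qed.

Lemma ex_grid_index (n a : nat) (k : int) : 0 < n%:R :> R ->
  `|k%:~R / n%:R| <= a%:R / n%:R :> R ->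
  exists i : 'I_(2 * a).+1, (i%:R - a%:R) / n%:R = k%:~R / n%:R :> R.
Proof.
move=> n0; rewrite normrM [`|n%:R^-1|]ger0_norm ?invr_ge0 ?(ltW n0)//.
rewrite ler_pM2r ?invr_gt0// ler_norml => /andP[ak ka].
have k0 : 0 <= k + a%:Z.
  by rewrite -(ler_int R) intrD -pmulrn mulr0z; lra.
have k2 : (absz (k + a%:Z)%R < (2 * a).+1)%N.
  rewrite ltnS -lez_nat gez0_abs// -(ler_int R) intrD -!pmulrn natrM; lra.
exists (Ordinal k2) => /=; congr (_ / _).
by rewrite pmulrn gez0_abs// intrD -pmulrn addrK.
Qed.

Lemma ex_xgrid (k : int) : `|k%:~R / (N ^ 2)%:R| <= N%:R :> R ->
  exists i : 'I_(2 * N ^ 3).+1, xgrid R i = k%:~R / (N ^ 2)%:R.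
Proof.
move=> kN; apply: ex_grid_index => //; apply: le_trans kN _.
by rewrite ler_pdivlMr// -natrM -expnS.
Qed.

Lemma ex_vgrid (u : R) : exists j : 'I_(2 * N ^ 2).+1, vgrid R j = sg u.
Proof.
have [k kE] : exists k : int, sg u = k%:~R / N%:R.
  rewrite /sg; case: ltP => _; [exists (- N%:Z)|exists N%:Z].
    by rewrite intrN -pmulrn mulNr divff// gt_eqF.
  by rewrite -pmulrn divff// gt_eqF.
rewrite kE; apply: ex_grid_index => //; rewrite -kE normr_sg.
by rewrite ler_pdivlMr// mul1r ler_nat expnS expn1 leq_pmulr.
Qed.

Variable g : R -> R.

Definition grid_floor (u : R) : R :=
  (Num.floor (g u * (N ^ 2)%:R))%:~R / (N ^ 2)%:R.

Lemma grid_floor_itv u :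
  grid_floor u <= g u < grid_floor u + (N ^ 2)%:R^-1.
Proof.
rewrite /grid_floor -[X in _ < _ + X]mul1r -mulrDl ler_pdivrMr// ltr_pdivlMr//.
by rewrite floor_le/= -[X in _ + X]/(1%:~R) -intrD floorD1_gt.
Qed.

Lemma grid_floor_dist u : `|grid_floor u - g u| <= (N ^ 2)%:R^-1.
Proof. by have := grid_floor_itv u; rewrite ler_norml; lra. Qed.

Hypothesis gnd : {homo g : u w / u <= w}.

Lemma grid_floor_homo : {homo grid_floor : u w / u <= w}.
Proof.
move=> u w uw; rewrite /grid_floor ler_pM2r ?invr_gt0// ler_int le_floor//.
by rewrite ler_pM2r// gnd.
Qed.

Variables (M T : R).
Hypotheses (gM : forall u, `|g u| <= M) (T0 : 0 <= T) (MTN : M + T + 1 <= N%:R).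

Let N2V1 : (N ^ 2)%:R^-1 <= 1 :> R.
Proof. by rewrite invf_le1// ler1n expn_gt0 N0. Qed.

(** A time step [1 / N] at unit speed is a displacement by [N] cells of width [1 / N^2]. The point
    stays in [[-N, N]] because the initial bound [M], the displacement [T] and a rounding error of
    at most [1] add up to at most [N]. *)
Lemma grid_floor_flow_grid (l : nat) (u : R) : l%:R / N%:R <= T ->
  exists i : 'I_(2 * N ^ 3).+1, xgrid R i = grid_floor u + l%:R / N%:R * sg u.
Proof.
move=> lT.
have [k kE] : exists k : int,
    grid_floor u + l%:R / N%:R * sg u = k%:~R / (N ^ 2)%:R.
  have E : (l * N)%:R / (N ^ 2)%:R = l%:R / N%:R :> R.
    by rewrite natrM expnS expn1 natrM -mulf_div divff ?mulr1// gt_eqF.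
  rewrite -E /grid_floor /sg; case: ltP => _.
    exists (Num.floor (g u * (N ^ 2)%:R) - (l * N)%:Z).
    by rewrite intrB -pmulrn mulrBl mulrN1.
  exists (Num.floor (g u * (N ^ 2)%:R) + (l * N)%:Z).
  by rewrite intrD -pmulrn mulrDl mulr1.
rewrite kE; apply: ex_xgrid; rewrite -kE; apply: le_trans MTN.
have := gM u; have := grid_floor_dist u; have := N2V1.
have : `|l%:R / N%:R * sg u| <= T.
  by rewrite normrM normr_sg mulr1 ger0_norm// divr_ge0.
have := ler_normD (grid_floor u) (l%:R / N%:R * sg u).
have := ler_normD (grid_floor u - g u) (g u); rewrite subrK; lra.
Qed.

Lemma LAS_init (mu0 : set R -> \bar R) (A : set R) :
  eq_meas mu0 (pushforward (U01 R) g) -> measurable A ->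
  (\sum_(i < (2 * N ^ 3).+1)
     mu0 `[xgrid R i, (xgrid R i + (N ^ 2)%:R^-1)%R[%classic *
     \d_(xgrid R i) A = pushforward (U01 R) grid_floor A)%E.
Proof.
move=> mu0g mA.
have cell u : exists2 i : 'I_(2 * N ^ 3).+1, xgrid R i = grid_floor u &
    xgrid R i <= g u < xgrid R i + (N ^ 2)%:R^-1.
  have lT : 0%:R / N%:R <= T by rewrite mul0r.
  have [i] := grid_floor_flow_grid u lT; rewrite !mul0r addr0 => iE.
  by exists i => //; rewrite iE grid_floor_itv.
under eq_bigr do rewrite mu0g//.
rewrite /pushforward;
  apply: (@sum_dirac_partition _ _ _ (U01 R) _ (fun i => g @^-1`
  `[xgrid R i, xgrid R i + (N ^ 2)%:R^-1[%classic) (@xgrid R N) grid_floor) =>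
    //.
- apply: homo_measurable; exact: grid_floor_homo.
- move=> i; rewrite -[_ @^-1` _]setTI; apply: homo_measurable => //.
- by move=> u; have [i _ iE] := cell u; exists i; rewrite /= in_itv.
- by move=> i j u; rewrite /= !in_itv/=; exact: xgrid_cell_inj.
- move=> i u; rewrite /= in_itv/=; have [j <- jE] := cell u.
  by move=> /(xgrid_cell_inj jE) ->.
Qed.

(** The rounded and displaced rearrangement is again nondecreasing, so the field at time [l / N] is
    the law of its values paired with [sg]. All levels in one cell share position and velocity, and
    [sum_dirac_partition] applies. *)
Lemma LAS_step (m : probability R R) (l : nat) (t : R) (A : set R) :
  l%:R / N%:R <= T ->
  eq_meas m (pushforward (U01 R) (fun u =>
    grid_floor u + l%:R / N%:R * sg u)) ->
  measurable A ->
  (\sum_(i < (2 * N ^ 3).+1) \sum_(j < (2 * N ^ 2).+1)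
     V_split m ([set xgrid R i] `*`
       `[vgrid R j, (vgrid R j + N%:R^-1)%R[%classic) *
     \d_(xgrid R i + t * vgrid R j)%R A =
   pushforward (U01 R) (fun u =>
     grid_floor u + (l%:R / N%:R + t) * sg u)%R A)%E.
Proof.
move=> lT mE mA.
have l0 : 0 <= l%:R / N%:R :> R by rewrite divr_ge0.
have hnd := homo_flow grid_floor_homo l0.
have mh := homo_measurable hnd.
have mV := V_split_rearr hnd mE.
(* The velocity is itself a grid point, so the cell containing it starts at it and no rounding of
   velocities occurs. *)
have cellv (j : 'I_(2 * N ^ 2).+1) u :
    vgrid R j <= sg u < vgrid R j + N%:R^-1 -> vgrid R j = sg u.
  have [k kE] := ex_vgrid u => jE; rewrite -kE; congr vgrid.
  by apply: vgrid_cell_inj jE _; rewrite kE lexx ltrDl invr_gt0.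
rewrite pair_bigA/=.
under eq_bigr => p _.
  rewrite mV; last by apply: measurableX;
    [exact: measurable_set1|exact: measurable_itv].
  over.
rewrite /pushforward; apply: (@sum_dirac_partition _ _ _ (U01 R) _ (fun p =>
  (fun u => (grid_floor u + l%:R / N%:R * sg u,
    sg u)) @^-1` ([set xgrid R p.1] `*`
    `[vgrid R p.2, (vgrid R p.2 + N%:R^-1)%R[%classic))
  (fun p => xgrid R p.1 + t * vgrid R p.2)) => //.
- by apply: measurable_flow; apply: homo_measurable; exact: grid_floor_homo.
- move=> i; rewrite -[_ @^-1` _]setTI.
  apply: measurable_fun_pair => //; [exact: measurable_sg|exact: measurableX].
- move=> u; have [i iE] := grid_floor_flow_grid u lT; have [j jE] := ex_vgrid u.
  by exists (i, j); rewrite /= in_itv/= iE jE lexx ltrDl invr_gt0.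
- move=> [i j] [i' j'] u /=; rewrite !in_itv/= => -[-> jE] [iE' jE'].
  congr pair; last exact: vgrid_cell_inj jE jE'.
  apply: (@xgrid_cell_inj _ _ (xgrid R i));
    first by rewrite lexx ltrDl invr_gt0.
  by rewrite iE' lexx ltrDl invr_gt0.
- by move=> [i j] u /=; rewrite in_itv/= => -[<- /cellv ->];
  rewrite mulrDl addrA.
Qed.

Lemma is_LAS_law (mu0 : Pc R) (mu : R -> probability R R) :
  eq_meas mu0 (pushforward (U01 R) g) ->
  (forall t, eq_meas (mu t)
     (pushforward (U01 R) (fun u => grid_floor u + t * sg u))) ->
  is_LAS (@V_split R) T N mu0 mu.
Proof.
move=> mu0g muE; split => [A mA|l t /andP[t0 tN] ltT A mA].
  by rewrite muE// flow0 (LAS_init mu0g).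
have lT : l%:R / N%:R <= T by apply: le_trans ltT; rewrite lerDl.
by rewrite muE// (LAS_step t lT (muE _)).
Qed.

(** The recursion determines the curve: by induction at the times [l / N], then at [t] from the step
    containing it, with [l] the integer part of [t * N]. *)
Lemma LAS_law (mu0 : Pc R) (mu : R -> probability R R) (t : R) :
  eq_meas mu0 (pushforward (U01 R) g) ->
  is_LAS (@V_split R) T N mu0 mu -> 0 <= t <= T ->
  eq_meas (mu t) (pushforward (U01 R) (fun u => grid_floor u + t * sg u)).
Proof.
move=> mu0g [mu_init mu_step].
have lE (l : nat) : l%:R / N%:R <= T -> eq_meas (mu (l%:R / N%:R))
    (pushforward (U01 R) (fun u => grid_floor u + l%:R / N%:R * sg u)).
  elim: l => [_ A mA|l IH].
    by rewrite mul0r flow0 mu_init// (LAS_init mu0g).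
  rewrite -natr1 mulrDl mul1r => lT A mA.
  have lT' : l%:R / N%:R <= T by apply: le_trans lT; rewrite lerDl invr_ge0.
  by rewrite mu_step ?lexx ?andbT ?invr_ge0// (LAS_step _ lT' (IH lT')).
move=> /andP[t0 tT] A mA.
pose l := absz (Num.floor (t * N%:R)).
have f0 : 0 <= Num.floor (t * N%:R) by rewrite floor_ge0 mulr_ge0.
have lR : l%:R = (Num.floor (t * N%:R))%:~R :> R by rewrite pmulrn gez0_abs.
have l1 : l%:R / N%:R <= t by rewrite ler_pdivrMr// lR floor_le.
have l2 : t <= l%:R / N%:R + N%:R^-1.
  rewrite -[X in _ + X]mul1r -mulrDl ler_pdivlMr// lR ltW//.
  by rewrite -[X in _ + X]/(1%:~R) -intrD floorD1_gt.
have lT := le_trans l1 tT.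
have -> : t = l%:R / N%:R + (t - l%:R / N%:R) by rewrite addrC subrK.
by rewrite mu_step ?(LAS_step _ lT (lE _ lT))//; lra.
Qed.

End lattice.

(** * Limits of lattice approximate solutions *)

Section LAS_limits.
Context (R : realType) (mu0 : Pc R) (g : R -> R) (M T : R).
Hypotheses (gnd : {homo g : u w / u <= w}) (gM : forall u, `|g u| <= M).
Hypotheses (mu0g : eq_meas mu0 (pushforward (U01 R) g)) (T0 : 0 < T).

Let mg := homo_measurable gnd.

Lemma grid_floor_cost (N : nat) (t : R) : (0 < N)%N ->
  (\int[U01 R]_u
    `|(grid_floor N g u + t * sg u) - (g u + t * sg u)|%:E <= (N%:R^-1)%:E)%E.
Proof.
move=> N0; have mgN := homo_measurable (grid_floor_homo N0 gnd).
apply: L1_le_cst => [||u]; [exact: measurable_flow|exact: measurable_flow|].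
rewrite opprD addrACA subrr addr0; apply: le_trans (grid_floor_dist N0 g u) _.
by rewrite lef_pV2 ?posrE ?ltr0n ?expn_gt0 ?N0// ler_nat expnS expn1 leq_pmulr.
Qed.

Lemma LAS_converge_law (mu : R -> Pc R) :
  (forall t, 0 <= t <= T ->
     eq_meas (mu t) (pushforward (U01 R) (fun u => g u + t * sg u))) ->
  LAS_converge (@V_split R) T id mu0 mu.
Proof.
move=> muE.
have /choice[nu nuE] : forall kt : nat * R, exists m : probability R R,
    (0 < kt.1)%N -> eq_meas m (pushforward (U01 R)
      (fun u => grid_floor kt.1 g u + kt.2 * sg u)).
  (* For the parameter [0] there is no grid and any probability will do, as only large parameters
     matter. *)
  move=> [[|k] t] /=; first by exists (U01 R).
  have [m mE] := ex_law (measurable_flow t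
    (homo_measurable (grid_floor_homo (ltn0Sn k) gnd))).
  by exists m.
exists (fun k t => nu (k, t)); split.
  near=> k.
  have k0 : (0 < k)%N by near: k; exact: nbhs_infty_gt.
  apply: (is_LAS_law k0 gnd gM (ltW T0)) => // [|t]; last exact: (nuE (k, t)).
  by near: k; exact: nbhs_infty_ger.
move=> e e0; near=> k => t; rewrite in_itv/= => tT.
have k0 : (0 < k)%N by near: k; exact: nbhs_infty_gt.
have t0 : 0 <= t by case/andP: tT.
rewrite (W1E (homo_flow (grid_floor_homo k0 gnd) t0) (homo_flow gnd t0)
  (nuE (k, t) k0) (muE t tT)).
apply: le_lt_trans (grid_floor_cost t k0) _.
rewrite lte_fin invf_plt ?posrE ?ltr0n//.
by near: k; exact: nbhs_infty_gtr.
Unshelve. all: by end_near. Qed.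

(** If [h] is a rearrangement of [mu t], its [L^1] distance to [g + t * sg] is at most the rounding
    error [1 / phi k] plus the [W1] distance of the approximation to [mu t]; both tend to zero, so
    the two functions agree almost everywhere. *)
Lemma LAS_limit_law (mu : R -> Pc R) : LAS_limit (@V_split R) T mu0 mu ->
  forall t, 0 <= t <= T ->
    eq_meas (mu t) (pushforward (U01 R) (fun u => g u + t * sg u)).
Proof.
move=> [phi phi_lt [muN [muN_LAS muN_cvg]]] t tT.
have t0 : 0 <= t by case/andP: tT.
(* A strictly increasing extraction dominates the identity, so largeness of [k] passes to
   [phi k]. *)
have phi_ge k : (k <= phi k)%N.
  by elim: k => // k /leq_ltn_trans; apply; exact: phi_lt.
have [M' M'0 SM'] := Pc_bounded (mu t).
have [h [hnd _ muh]] := ex_rearrangement M'0 SM'.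
have mh := homo_measurable hnd.
have mf := measurable_flow t mg.
suff gh : {ae U01 R, forall u, g u + t * sg u = h u}.
  by move=> A mA; rewrite muh//; apply/esym/ae_eq_law.
apply: L1_eq0 => //; apply/lee_addgt0Pr => e e0; rewrite add0e.
have e20 : 0 < e / 2 by rewrite divr_gt0.
near \oo => k.
have kphi : (k%:R : R) <= (phi k)%:R by rewrite ler_nat.
have k0 : (0 < k)%N by near: k; exact: nbhs_infty_gt.
have phi0 : (0 < phi k)%N by exact: leq_trans (phi_ge k).
have kM : M + T + 1 <= (phi k)%:R.
  by apply: le_trans kphi; near: k; exact: nbhs_infty_ger.
have muNE : eq_meas (muN k t) (pushforward (U01 R)
    (fun u => grid_floor (phi k) g u + t * sg u)).
  apply: (LAS_law phi0 gnd gM (ltW T0) kM mu0g) => //.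
  by near: k.
have W : (W1 (muN k t) (mu t) < (e / 2)%:E)%E.
  have tT' : t \in `[0, T] by rewrite in_itv.
  (* The convergence is uniform in time, hence [t] is generalised to match the eventual property of
     [k]. *)
  by move: t tT' {tT t0 SM' muh mf muNE}; near: k; exact: muN_cvg.
rewrite (W1E (homo_flow (grid_floor_homo phi0 gnd) t0) hnd muNE muh) in W.
have mgk := homo_measurable (grid_floor_homo phi0 gnd).
apply: le_trans (L1_triangle mf mh (measurable_flow t mgk)) _.
rewrite [in leRHS](splitr e) EFinD; apply: leeD; last exact: ltW.
under eq_integral do rewrite distrC.
apply: le_trans (grid_floor_cost t phi0) _.
rewrite lee_fin invf_ple ?posrE ?ltr0n//; apply: le_trans kphi.
by near: k; exact: nbhs_infty_ger.
Unshelve. all: by end_near. Qed.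

End LAS_limits.

(** * Solutions *)

Section test_functions.
Context (R : realType).

Lemma bounded_of_support (f : R -> R) (K : set R) : continuous f -> compact K ->
  (forall x, ~ K x -> f x = 0) -> exists2 C : R, 0 <= C & forall x, `|f x| <= C.
Proof.
move=> cf cK f0.
have /compact_bounded[M [_ HM]] :=
  continuous_compact (continuous_subspaceT cf) cK.
exists (`|M| + 1) => [|x]; first by rewrite addr_ge0.
have [Kx|/f0 ->] := pselect (K x); last by rewrite normr0 addr_ge0.
by apply: HM; [rewrite ltr_pwDr// ler_norm|exists x].
Qed.

Variable f : R -> R.
Hypothesis tf : test_function f.

Lemma test_function_is_derive (x : R) : is_derive x 1 f (derive1 f x).
Proof. by case: tf => df _; apply: DeriveDef;
  [exact: (df 0)|rewrite derive1E]. Qed.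

Lemma test_function_continuous : continuous f.
Proof.
move=> x; apply/differentiable_continuous/derivable1_diffP.
by case: tf => df _; exact: (df 0).
Qed.

Lemma test_function_derive1_continuous : continuous (derive1 f).
Proof.
move=> x; apply/differentiable_continuous/derivable1_diffP.
by case: tf => df _; exact: (df 1).
Qed.

Lemma test_function_bounded : exists2 C : R, 0 <= C & forall x, `|f x| <= C.
Proof.
case: tf => _ cK; apply: bounded_of_support cK _;
  first exact: test_function_continuous.
move=> x Kx; apply/eqP; apply: contrapT => /negP fx.
by apply: Kx; exact: subset_closure.
Qed.

(** The complement of the closed support is open and [f] vanishes on it, so [f] is locally constant
    there and its derivative vanishes as well. *)
Lemma test_function_derive1_bounded :
  exists2 C : R, 0 <= C & forall x, `|derive1 f x| <= C.
Proof.
case: tf => _ cK; apply: bounded_of_support cK _.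
  exact: test_function_derive1_continuous.
move=> x Kx; rewrite derive1E.
rewrite (near_eq_derive (g := cst 0)) ?derive_cst//.
have /open_nbhs_nbhs : open_nbhs x (~` closure [set x | f x != 0]).
  by split => //; apply: closed_openC; exact: closed_closure.
apply: filterS => y /= Ky; apply/eqP; apply: contrapT => /negP fy.
by apply: Ky; exact: subset_closure.
Qed.

End test_functions.

Section solutions.
Context (R : realType).

Lemma U01_bounded_integrable (F : R -> R) (C : R) : measurable_fun setT F ->
  (forall u, `|F u| <= C) -> (U01 R).-integrable setT (EFin \o F).
Proof.
move=> mF FC; apply: measurable_bounded_integrable => //.
  by apply: le_lt_trans (ltry 1); apply: probability_le1; exact: measurableT.
by exists C; split=> [|M CM u _ /=];
  [exact: num_real|exact: le_trans (FC u) (ltW CM)].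
Qed.

Variables (g : R -> R) (f : R -> R).
Hypotheses (gnd : {homo g : u w / u <= w}) (tf : test_function f).

Let mg := homo_measurable gnd.
Let pair (t : R) : R := \int[U01 R]_u f (g u + t * sg u).
Let vel (t : R) : R := \int[U01 R]_u (derive1 f (g u + t * sg u) * sg u).

Let mfg t : measurable_fun setT (fun u => f (g u + t * sg u)).
Proof.
apply: (@measurableT_comp _ _ _ _ _ _ f); last exact: measurable_flow.
by apply: continuous_measurable_fun; exact: test_function_continuous.
Qed.

Let mdfg t : measurable_fun setT (fun u => derive1 f (g u + t * sg u) * sg u).
Proof.
apply: measurable_funM; last exact: measurable_sg.
apply: (@measurableT_comp _ _ _ _ _ _ (derive1 f)); last exact: measurable_flow.
by apply: continuous_measurable_fun; exact: test_function_derive1_continuous.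
Qed.

Let dfg u (t : R) : is_derive t 1 (fun t => f (g u + t * sg u))
  (derive1 f (g u + t * sg u) * sg u).
Proof.
have := test_function_is_derive tf (g u + t * sg u) => df.
apply: (@is_derive1_comp _ f (fun t => g u + t * sg u)).
by apply: is_derive_eq; rewrite add0r mul1r scaler0 add0r [_%:A]mulr1.
Qed.

Let pair_integrable t :
  (U01 R).-integrable setT (EFin \o (fun u => f (g u + t * sg u))).
Proof.
have [C C0 fC] := test_function_bounded tf.
exact: U01_bounded_integrable.
Qed.

Let vel_integrable t :
  (U01 R).-integrable setT
    (EFin \o (fun u => derive1 f (g u + t * sg u) * sg u)).
Proof.
have [C C0 fC] := test_function_derive1_bounded tf.
apply: (@U01_bounded_integrable _ C) => // u.
by rewrite normrM normr_sg mulr1.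
Qed.

(** Differentiation under the integral sign, on the neighbourhood []t - 1, t + 1[] of [t]. As
    velocities have modulus one, a bound of the derivative of [f] dominates the integrand. *)
Lemma flow_pairing_is_derive (t : R) : is_derive t 1 pair (vel t).
Proof.
have [C C0 fC] := test_function_derive1_bounded tf.
have tI : `]t - 1, t + 1[%classic t by rewrite /= in_itv/=; lra.
have dE (x u : R) : partial1of2 (fun t u => f (g u + t * sg u)) x u =
    derive1 f (g u + x * sg u) * sg u.
  by rewrite partial1of2E; exact: derive_val.
have intC : (U01 R).-integrable setT (EFin \o (fun=> C)).
  by apply: (@U01_bounded_integrable _ C) => // u; rewrite ger0_norm.
have d1 (x u : R) : `]t - 1, t + 1[%classic x -> [set: R] u ->
    derivable (fun t : R => f (g u + t * sg u)) x 1.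
  by move=> _ _; have [] := dfg u x.
have G1 (x u : R) : `]t - 1, t + 1[%classic x -> [set: R] u ->
    `|partial1of2 (fun t u => f (g u + t * sg u)) x u| <= C.
  by rewrite dE normrM normr_sg mulr1.
have i1 (x : R) : `]t - 1, t + 1[%classic x ->
  (U01 R).-integrable setT (EFin \o (fun u => f (g u + x * sg u))) by [].
apply: DeriveDef.
  exact: (derivable_under_integral measurableT tI i1 d1 (fun=> C0) intC G1).
rewrite -derive1E.
rewrite (differentiation_under_integral measurableT tI i1 d1 (fun=>
  C0) intC G1).
by apply: eq_Rintegral => u _; rewrite dE.
Qed.

(** Continuity makes the velocity integrable on the compact [[0, T]], hence a valid Borel
    representative in the definition of solutions. *)
Lemma flow_velocity_continuous : continuous vel.
Proof.
have [C C0 fC] := test_function_derive1_bounded tf.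
move=> t.
have tI : t \in `]t - 1, t + 1[%classic by rewrite inE /= in_itv/=; lra.
have intC : (U01 R).-integrable setT (EFin \o (fun=> C)).
  by apply: (@U01_bounded_integrable _ C) => // u; rewrite ger0_norm.
apply: (continuity_under_integral (g := fun=> C) measurableT _ _ intC _ tI) =>
  //.
- apply: aeW => u _ x _.
  apply: cvgM; last exact: cvg_cst.
  apply: continuous_comp; last exact: test_function_derive1_continuous.
  by apply: cvgD; [exact: cvg_cst|apply: cvgM; [exact: cvg_id|exact: cvg_cst]].
- by move=> x _; apply: aeW => u _; rewrite normrM normr_sg mulr1.
Qed.

(** Mean value theorem, the derivative being bounded by a bound of that of [f]. Absolute continuity
    of the pairing follows. *)
Lemma flow_pairing_lipschitz : exists2 C : R, 0 <= C &
  forall s t : R, s <= t -> `|pair t - pair s| <= C * (t - s).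
Proof.
have [C C0 fC] := test_function_derive1_bounded tf.
have velC t : `|vel t| <= C.
  apply: le_trans (le_normr_Rintegral _ _) _ => //.
  rewrite -[leRHS](_ : \int[U01 R]_u C = C); last first.
    by rewrite /Rintegral integral_cst//= probability_setT mule1.
  apply: le_Rintegral => //.
  - by apply: (@U01_bounded_integrable _ C) => [|u];
    [apply: measurableT_comp => //;
    exact: mdfg|rewrite normr_id normrM normr_sg mulr1].
  - by apply: (@U01_bounded_integrable _ C) => // u; rewrite ger0_norm.
  by move=> u _; rewrite normrM normr_sg mulr1.
exists C => // s t; rewrite le_eqVlt => /orP[/eqP ->|st].
  by rewrite !subrr normr0 mulr0.
have cp : {within `[s, t], continuous pair}.
  apply: derivable_within_continuous => x _.
  by have [] := flow_pairing_is_derive x.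
have [c _ ->] := MVT st (fun x _ => flow_pairing_is_derive x) cp.
by rewrite normrM [`|t - s|]gtr0_norm ?subr_gt0// ler_wpM2r// subr_ge0 ltW.
Qed.

End solutions.

Section flow_solution.
Context (R : realType) (T : R) (mu : R -> Pc R) (g : R -> R).
Hypotheses (gnd : {homo g : u w / u <= w}).
Hypothesis mug : forall t, 0 <= t <= T ->
  eq_meas (mu t) (pushforward (U01 R) (fun u => g u + t * sg u)).

Let mg := homo_measurable gnd.

Lemma flow_is_solution : is_solution (@V_split R) T mu.
Proof.
move=> f tf rhs pairing.
pose pair t : R := \int[U01 R]_u f (g u + t * sg u).
pose vel t : R := \int[U01 R]_u (derive1 f (g u + t * sg u) * sg u).
have mf : measurable_fun setT f.
  by apply: continuous_measurable_fun; exact: test_function_continuous.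
have mdf : measurable_fun setT (derive1 f).
  by apply: continuous_measurable_fun; exact: test_function_derive1_continuous.
have pairE t : 0 <= t <= T -> pairing t = pair t.
  move=> tT; rewrite /pairing (law_Rintegral (measurable_flow t mg) (mug tT))//.
  have [C C0 fC] := test_function_bounded tf.
  apply: (@U01_bounded_integrable _ _ C) => [|u]; last exact: fC.
  by apply: measurableT_comp => //; exact: measurable_flow.
have mF : measurable_fun setT (fun p : R * R => derive1 f p.1 * p.2).
  apply: measurable_funM; last exact: measurable_snd.
  exact: measurableT_comp mdf measurable_fst.
have intF t : (U01 R).-integrable setT
    (EFin \o ((fun p : R * R => derive1 f p.1 * p.2) \o
              (fun u => (g u + t * sg u, sg u)))).
  have [C C0 fC] := test_function_derive1_bounded tf.
  apply: (@U01_bounded_integrable _ _ C) => [|u]; last first.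
    by rewrite /= normrM normr_sg mulr1.
  apply: measurableT_comp => //; apply: measurable_fun_pair.
    exact: measurable_flow.
  exact: measurable_sg.
have mgs t : measurable_fun setT (fun u => (g u + t * sg u, sg u)).
  by apply: measurable_fun_pair; [exact: measurable_flow|exact: measurable_sg].
have rhsE t : 0 <= t <= T ->
    (V_split (mu t)).-integrable setT (fun p => (derive1 f p.1 * p.2)%:E) /\
    rhs t = vel t.
  move=> tT; have t0 : 0 <= t by case/andP: tT.
  have lV := V_split_rearr (homo_flow gnd t0) (mug tT); split.
    by apply: (law_integrable (mgs t) lV); [exact/measurable_EFinP|exact: intF].
  by rewrite /rhs (law_Rintegral (mgs t) lV).
split.
- exists vel; split.
    apply: continuous_compact_integrable; first exact: segment_compact.
    by apply: continuous_subspaceT; exact: flow_velocity_continuous.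
  by apply: aeW => s; rewrite in_itv/=; exact: rhsE.
- have [C C0 pairC] := flow_pairing_lipschitz gnd tf.
  (* The [1] in the denominator covers the case where the Lipschitz constant is zero. *)
  move=> e e0; exists (e / (C + 1)); first by rewrite divr_gt0// ltr_wpDl.
  move=> n u v uv _ uvd.
  apply: (@le_lt_trans _ _ (\sum_(i < n) C * (v i - u i))).
    apply: ler_sum => i _; have [ui [uvi vi]] := uv i.
    rewrite !pairE ?ui ?vi ?(le_trans ui uvi) ?(le_trans uvi vi)//.
    exact: pairC.
  rewrite -mulr_sumr; apply: (@le_lt_trans _ _ (C * (e / (C + 1)))).
    by rewrite ler_wpM2l// ltW.
  by rewrite mulrCA gtr_pMr// ltr_pdivrMr ?ltr_wpDl// mul1r ltrDl.
(* The law of [mu t] is known for [t] in [[0, T]] only, so the pairing agrees with the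
   differentiable [pair] on a neighbourhood of interior times; the two endpoints form the
   exceptional null set. *)
- exists ([set 0] `|` [set T]); split.
  + by apply: measurableU; exact: measurable_set1.
  + by rewrite measureU0//; exact: lebesgue_measure_set1.
  move=> t /= nt; apply: contrapT => /not_orP[/eqP t0 /eqP tT]; apply: nt.
  rewrite in_itv/= => t0T.
  have [_ ->] := rhsE _ t0T.
  apply: near_eq_is_derive (flow_pairing_is_derive gnd tf t).
  have : t \in `]0, T[.
    by case/andP: t0T => t0' tT';
      rewrite in_itv/= !lt_neqAle t0' tT' tT eq_sym t0.
  move=> /near_in_itvoo; apply: filterS => s; rewrite in_itv/= => /andP[s0 sT].
  by rewrite pairE// !ltW.
Qed.

End flow_solution.

(** * Translations and the explicit formula *)

Section translation.
Context (R : realType).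

(** The image of Lebesgue measure under a translation has the same values on half-open intervals,
    which characterise Lebesgue measure. *)
Lemma lebesgue_measure_shift (c : R) (A : set R) : measurable A ->
  lebesgue_measure ((fun x => x + c) @^-1` A) = lebesgue_measure A.
Proof.
move=> mA.
have mc : measurable_fun setT ((fun x => x + c) : measurableTypeR R ->
  measurableTypeR R).
  exact: measurable_funD.
pose f := HB.pack_for {mfun measurableTypeR R >-> measurableTypeR R}
  ((fun x => x + c) : measurableTypeR R -> measurableTypeR R)
  (isMeasurableFun.Build _ _ _ _ _ mc).
apply/esym; apply: (lebesgue_measure_unique (mu :=
  pushforward lebesgue_measure f)) => //.
move=> _ [[a b] _ <-]; transitivity (lebesgue_measure `]a - c, b - c]%classic).
  by rewrite !lebesgue_measure_itv/= !lte_fin ltrD2r -!EFinB opprB addrA subrK.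
congr lebesgue_measure; apply/seteqP.
by split => x /=; rewrite !in_itv/= ltrBlDr lerBrDr.
Qed.

End translation.

Section explicit_formulas.
Context (R : realType) (mu0 : probability R R) (g : R -> R).
Hypotheses (gnd : {homo g : u w / u <= w}).
Hypothesis mug : eq_meas mu0 (pushforward (U01 R) g).
Local Open Scope ereal_scope.

(** The flow at time [t] is the image of [V_split mu0] under [(x, v) |-> x + t v], so the formula is
    [V_splitE] at the preimage [A'] of [A]. *)
Lemma flow_formula (t : R) (A : set R) : measurable A ->
  pushforward (U01 R) (fun u => g u + t * sg u)%R A =
  mu0 ((fun x => (x + t)%R) @` (A `&` `]-oo, (Bpt mu0 - t)%R[)) +
  mu0 ((fun x => (x - t)%R) @` (A `&` `](Bpt mu0 + t)%R, +oo[)) +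
  (eta_of mu0)%:E * \d_(Bpt mu0 + t)%R A +
  ((2^-1)%:E - mu0 `]-oo, Bpt mu0[%classic) * \d_(Bpt mu0 - t)%R A.
Proof.
move=> mA.
pose A' : set (R * R) := (fun p => p.1 + t * p.2)%R @^-1` A.
have mA' : measurable A'.
  rewrite -[A']setTI; apply: (_ : measurable_fun setT _) => //.
  apply: measurable_funD => //; apply: measurable_funM => //.
transitivity (V_split mu0 A'); first by rewrite (V_split_rearr gnd mug).
rewrite V_splitE// -[RHS]addeA; congr (mu0 _ + mu0 _ + (_ * _ + _ * _)).
- apply/seteqP; split => [x [xB]|_ [x [Ax /[swap] <-]]].
    rewrite /A'/= mulrN1 => Ax; exists (x - t)%R; last by rewrite subrK.
    by split => //; rewrite /= in_itv/= ltrD2r.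
  by rewrite /= in_itv/= ltrBrDr /A'/= mulrN1 addrK.
- apply/seteqP; split => [x [xB]|_ [x [Ax /[swap] <-]]].
    rewrite /A'/= mulr1 => Ax; exists (x + t)%R; last by rewrite addrK.
    by split => //; rewrite /= in_itv/= andbT ltrD2r.
  by rewrite /= in_itv/= andbT ltrBrDr /A'/= mulr1 subrK.
- by rewrite !diracE (_ : (_ \in A') = ((Bpt mu0 + t * 1)%R \in A))// mulr1.
- by rewrite !diracE (_ : (_ \in A') = ((Bpt mu0 + t * -1)%R \in A))// mulrN1.
Qed.

End explicit_formulas.

(** * Explicit initial data *)

Section special_data.
Context (R : realType).
Local Open Scope ereal_scope.

Lemma dirac_law (mu0 : set R -> \bar R) (x0 : R) : eq_meas mu0 \d_x0 ->
  eq_meas mu0 (pushforward (U01 R) (fun=> x0)).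
Proof.
move=> mux A mA; rewrite mux// /pushforward diracE.
have [xA|xA] := boolP (x0 \in A).
  by rewrite (_ : _ @^-1` _ = setT) ?probability_setT//; apply/seteqP;
    split=> // u _; exact: set_mem.
rewrite (_ : _ @^-1` _ = set0) ?measure0//; apply/seteqP;
  split => // u /= /mem_set.
by rewrite (negbTE xA).
Qed.

Lemma U01_itvcy : U01 R `[(2^-1)%R, +oo[%classic = (2^-1)%:E.
Proof.
rewrite (_ : `[(2^-1)%R, +oo[%classic = ~` `]-oo, (2^-1)%R[%classic);
  last first.
  by apply/seteqP; split => x; rewrite /= !in_itv/= andbT leNgt => /negP.
rewrite probability_setC; last exact: measurable_itv.
rewrite U01_itvNyo ?half01// -EFinB; congr EFin; lra.
Qed.

(** Computed directly from the constant rearrangement of a Dirac mass: each half of the levels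
    carries mass [1/2] to one of the two points. *)
Lemma dirac_flow (x0 t : R) (A : set R) : measurable A ->
  pushforward (U01 R) (fun u => x0 + t * sg u)%R A =
  (2^-1)%:E * \d_(x0 + t)%R A + (2^-1)%:E * \d_(x0 - t)%R A.
Proof.
move=> mA; rewrite /pushforward.
rewrite -(@sum_dirac_partition _ _ _ (U01 R) bool
  (fun b => if b then `[(2^-1)%R, +oo[%classic else `]-oo, (2^-1)%R[%classic)
  (fun b => if b then (x0 + t)%R else (x0 - t)%R)) //.
- by rewrite big_bool/= U01_itvcy U01_itvNyo// half01.
- exact: (@measurable_flow _ (fun=> x0)).
- by case; exact: measurable_itv.
- move=> u; exists (2^-1 <= u)%R; case: leP => u2;
  by rewrite /= in_itv/= ?andbT.
- by move=> [] [] u //; rewrite /= !in_itv/= andbT leNgt; case: ltP.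
- move=> [] u /=; rewrite in_itv/= ?andbT /sg => u2;
  first by rewrite ltNge u2 mulr1.
  by rewrite u2 mulrN1.
Qed.

Section uniform.
Variables (mu0 : probability R R) (a b : R).
Hypothesis ab : (a < b)%R.
Hypothesis muab : eq_meas mu0 (fun A => \int[lebesgue_measure]_(x in A)
  ((b - a)^-1 * \1_(`[a, b]%classic) x)%:E).

Let ba0 : (0 < (b - a)^-1)%R. Proof. by rewrite invr_gt0 subr_gt0. Qed.

Let muE (A : set R) : measurable A ->
  mu0 A = ((b - a)^-1)%:E * lebesgue_measure (A `&` `[a, b]%classic).
Proof.
move=> mA; rewrite muab//.
under eq_integral do rewrite EFinM.
rewrite ge0_integralZl//.
- by rewrite integral_indic// setIC.
- by apply/measurable_EFinP; apply: measurable_funTS; exact: measurable_indic.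
- by rewrite lee_fin ltW.
Qed.

Let mu_itvNyc (x : R) : (a <= x <= b)%R -> mu0 `]-oo, x]%classic =
  ((x - a) / (b - a))%:E.
Proof.
move=> /andP[ax xb]; rewrite muE//.
rewrite (_ : _ `&` _ = `[a, x]%classic); last first.
  apply/seteqP; split=> y; rewrite /= !in_itv/=; first by move=> [-> /andP[->]].
  by move=> /andP[-> yx]; rewrite yx (le_trans yx).
rewrite lebesgue_measure_itv/= lte_fin mulrC EFinM; congr (_ * _).
by case: ltgtP ax => // -> _; rewrite subrr.
Qed.

Let mu_itvNyo (x : R) : (a <= x <= b)%R -> mu0 `]-oo, x[%classic =
  ((x - a) / (b - a))%:E.
Proof.
move=> /andP[ax xb]; rewrite muE//.
rewrite (_ : _ `&` _ = `[a, x[%classic); last first.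
  apply/seteqP; split=> y; rewrite /= !in_itv/=; first by move=> [-> /andP[->]].
  by move=> /andP[-> yx]; rewrite yx (le_trans (ltW yx)).
rewrite lebesgue_measure_itv/= lte_fin mulrC EFinM; congr (_ * _).
by case: ltgtP ax => // -> _; rewrite subrr.
Qed.

Let m : R := ((a + b) / 2)%R.

Let am : (a <= m <= b)%R.
Proof. by have := ab; rewrite /m => ab'; apply/andP; split; lra. Qed.

Let half_m : ((m - a) / (b - a) = 2^-1)%R.
Proof. by rewrite /m; field; rewrite subr_eq0 gt_eqF. Qed.

(** On [[a, b]] the distribution function is affine and strictly increasing, with value [1/2] at the
    midpoint; a median on either side would contradict [lt_Bpt_le_half] or [half_le_Bpt]. *)
Lemma uniform_Bpt : Bpt mu0 = m.
Proof.
apply/eqP; rewrite eq_le; apply/andP; split; rewrite leNgt; apply/negP => Bm.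
  have := lt_Bpt_le_half mu0; rewrite leNgt => /negP; apply.
  (* The affine expression is only available on [[a, b]], hence the truncation at [b]. *)
  pose x := Num.min (Bpt mu0) b.
  have mx : (m < x)%R by have := ab; rewrite /x lt_min Bm/= /m => ab'; lra.
  have xB : (x <= Bpt mu0)%R by rewrite /x ge_min lexx.
  have xab : (a <= x <= b)%R.
    by rewrite /x ge_min lexx orbT andbT ltW// (le_lt_trans _ mx)//;
      case/andP: am.
  apply: (@lt_le_trans _ _ (mu0 `]-oo, x[%classic)).
    by rewrite mu_itvNyo// lte_fin -half_m ltr_pM2r// ltrD2r.
  by apply: le_measure; rewrite ?inE//; apply: subset_itvl; rewrite bnd_simp.
have := half_le_Bpt mu0; rewrite leNgt => /negP; apply.
pose x := Num.max (Bpt mu0) a.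
have mx : (x < m)%R by have := ab; rewrite /x gt_max Bm/= /m => ab'; lra.
have xB : (Bpt mu0 <= x)%R by rewrite /x le_max lexx.
have xab : (a <= x <= b)%R.
  by rewrite /x le_max lexx orbT ltW// (lt_le_trans mx)//; case/andP: am.
apply: (@le_lt_trans _ _ (mu0 `]-oo, x]%classic)).
  by apply: le_measure; rewrite ?inE//; apply: subset_itvl; rewrite bnd_simp.
by rewrite mu_itvNyc// lte_fin -half_m ltr_pM2r// ltrD2r.
Qed.

Lemma uniform_flow (t : R) (g : R -> R) (A : set R) :
  {homo g : u w / (u <= w)%R} -> eq_meas mu0 (pushforward (U01 R) g) ->
  measurable A ->
  pushforward (U01 R) (fun u => g u + t * sg u)%R A =
  \int[lebesgue_measure]_(x in A) ((b - a)^-1 *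
    (\1_(`[a - t, (a + b) / 2 - t]%classic) x +
     \1_(`[(a + b) / 2 + t, b + t]%classic) x))%:E.
Proof.
move=> gnd mug mA; rewrite (flow_formula gnd mug)//.
have mI (C : set R) : measurable C -> measurable_fun A (fun x : R =>
  (\1_C x)%:E : \bar R).
  by move=> mC; apply/measurable_EFinP; apply: measurable_funTS;
    exact: measurable_indic.
(* The half-lines ending at the midpoint have mass exactly [1/2], so both Dirac terms vanish. *)
rewrite /eta_of uniform_Bpt mu_itvNyc// mu_itvNyo// half_m /=
  subrr -EFinB subrr.
rewrite !mul0e !adde0 -/m.
under [RHS]eq_integral do rewrite EFinM EFinD.
rewrite ge0_integralZl//; last 3 first.
- by apply: emeasurable_funD; exact: mI.
- by move=> x _; rewrite adde_ge0// lee_fin.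
- by rewrite lee_fin ltW.
rewrite ge0_integralD//; [|exact: mI|exact: mI].
rewrite !integral_indic// ge0_muleDr//.
have mshift (c : R) (C : set R) : measurable C -> measurable [set x : R |
  C (x + c)%R].
  move=> mC; rewrite -[X in measurable X]setTI.
  have mc : measurable_fun [set: R] (fun x =>
    x + c)%R by exact: measurable_funD.
  exact: (mc measurableT C mC).
have /andP[am1 am2] := am.
have image_shift (c : R) (C : set R) :
    (fun x => x + c)%R @` C = [set x : R | C (x - c)%R].
  apply/seteqP; split => [_ [x Cx <-]|x Cx]; first by rewrite /= addrK.
  by exists (x - c)%R => //; rewrite subrK.
rewrite !image_shift !muE; last 2 first.
- by apply: mshift; exact: measurableI.
- by apply: mshift; exact: measurableI.
congr (_ * _ + _ * _).
- rewrite -[RHS](lebesgue_measure_shift (- t)); last first.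
    by apply: measurableI => //; exact: measurable_itv.
  apply: ae_eq_measure; [|  |].
  + by apply: measurableI => //; apply: mshift; exact: measurableI.
  + by apply: mshift; exact: measurableI.
  (* The general formula uses an open half-line at the median and the target interval is closed:
     after translation the two sets differ at most at the midpoint. *)
  exists [set m]; split; [exact: measurable_set1|exact: lebesgue_measure_set1|].
  move=> x /= nx; apply: contrapT => xm; apply: nx.
  rewrite !in_itv/=; split.
    by move=> [[Ax xm'] /andP[ax xb]]; split => //; apply/andP; split; lra.
  move=> [/andP[ax mx] Ax]; split; last by apply/andP; split; lra.
  by split => //; rewrite ltrD2r lt_neqAle; apply/andP; split; [apply/eqP|lra].
- rewrite opprK -[RHS](lebesgue_measure_shift t); last first.
    by apply: measurableI => //; exact: measurable_itv.
  apply: ae_eq_measure; [|  |].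
  + by apply: measurableI => //; apply: mshift; exact: measurableI.
  + by apply: mshift; exact: measurableI.
  exists [set m]; split; [exact: measurable_set1|exact: lebesgue_measure_set1|].
  move=> x /= nx; apply: contrapT => xm; apply: nx.
  rewrite !in_itv/= !andbT; split.
    by move=> [[Ax xm'] /andP[ax xb]]; split => //; apply/andP; split; lra.
  move=> [/andP[ax mx] Ax]; split; last by apply/andP; split; lra.
  by split => //; rewrite ltrD2r lt_neqAle eq_sym; apply/andP; split;
    [apply/eqP|lra].
Qed.

End uniform.

End special_data.

(** * The semigroup *)

(** Measurability in the plane refers to the product sigma-algebra, whereas supports are tested on
    open sets; an open set is a countable union of rational rectangles. *)
Lemma open_measurable_prod (R : realType) (U : set (R * R)) :
  open U -> measurable U.
Proof.
move=> oU.
pose I (q : (rat * rat) * (rat * rat)) := @rat_itv R q.1 `*` @rat_itv R q.2.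
pose F n := if unpickle n is Some q then
  if `[< I q `<=` U >] then I q else set0 else set0.
rewrite (_ : U = \bigcup_n F n).
  apply: bigcup_measurable => n _; rewrite /F; case: unpickle => // q.
  by case: asboolP => // _; apply: measurableX; exact: measurable_itv.
apply/seteqP; split => [[x y] Uxy|p [n _]]; last first.
  by rewrite /F; case: unpickle => // q; case: asboolP => // qU /qU.
have /nbhs_ballP[e /= e0 xeU] : nbhs (x, y) U by exact: open_nbhs_nbhs.
have [q1 [q1x q1e]] := ex_rat_itv_ball x e0.
have [q2 [q2y q2e]] := ex_rat_itv_ball y e0.
have := pickleK (q1, q2); move: (pickle _) => n nE; exists n => //.
rewrite /F nE asboolT// => -[z1 z2] [/= /q1e z1e /q2e z2e].
exact: xeU.
Qed.

Section split_field.
Context (R : realType).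
Local Notation V := (@V_split R).

Lemma Pc_rearrangement (mu : Pc R) : exists g : R -> R,
  [/\ {homo g : u w / u <= w},
  (exists M : R, forall u, `|g u| <= M) & eq_meas mu (pushforward (U01 R) g)].
Proof.
have [M M0 SM] := Pc_bounded mu.
have [g [gnd gM mug]] := ex_rearrangement M0 SM.
by exists g; split => //; exists M.
Qed.

Lemma split_is_PVF : is_PVF V.
Proof.
move=> mu A mA; rewrite /pushforward/= /otimes.
under eq_integral => x _.
  rewrite (_ : (fun v => _) = (fun=> (\1_A x)%:E)); last by apply/funext.
  rewrite integral_cst// (_ : nu_kernel mu x setT = 1%E) ?mule1; last first.
    exact: (@prob_kernel _ _ _ _ _ (nu_kernel mu) x).
  over.
by rewrite integral_indic// setIT.
Qed.

Lemma split_support_sublinear : support_sublinear V 1.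
Proof.
move=> mu; have [g [gnd _ mug]] := Pc_rearrangement mu.
have lV := V_split_rearr gnd mug.
rewrite mul1e; apply: (@le_trans _ _ 1%:E).
  apply: ge_ereal_sup => _ [p pV <-]; rewrite lee_fin leNgt; apply/negP => p1.
  have oU : open [set q : R * R | 1 < `|q.2|].
    apply: (@open_comp _ _ (fun q : R * R => `|q.2|) [set x | 1 < x]).
      by move=> q _; apply: (@continuous_comp _ _ _ snd (fun x : R => `|x|));
        [exact: cvg_snd|exact: norm_continuous].
    exact: open_gt.
  have mU : measurable [set q : R * R | 1 < `|q.2|].
    apply: measurable_set_ltr => //.
    by apply: measurableT_comp => //; exact: measurable_snd.
  have := pV _ oU p1; rewrite lV// /pushforward (_ : _ @^-1` _ =
    set0) ?measure0 ?ltxx//.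
  by apply/seteqP; split => // u /=; rewrite normr_sg ltxx.
(* A point of the support makes the supremum on the right nonnegative; over an empty set it would be
   [-oo]. *)
have [x Sx] := Supp_nonempty mu.
rewrite leeDl//; apply: (@le_trans _ _ `|x|%:E); first by rewrite lee_fin.
by apply: ereal_sup_ubound; exists x.
Qed.

Lemma split_locally_calW_Lipschitz : locally_calW_Lipschitz V.
Proof.
(* Any positive constant would serve, the left-hand side being at most zero. *)
move=> r _; exists 1 => // mu nu _ _.
have [g [gnd _ mug]] := Pc_rearrangement mu.
have [h [hnd _ nuh]] := Pc_rearrangement nu.
apply: le_trans (calW_split gnd hnd mug nuh) _.
by rewrite mul1e (W1E gnd hnd mug nuh) integral_ge0.
Qed.

(* Tested on the Dirac mass at the origin. *)
Lemma support_sublinear_ge1 (C : R) : 0 < C -> support_sublinear V C -> 1 <= C.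
Proof.
move=> C0 VC; have mc : measurable_fun [set: R] (fun=>
  (0 : R)) by exact: measurable_cst.
have [m mE] := ex_law mc.
have [S0 cS] : Supp m `<=` `[- (0 : R), 0]%classic /\ compact (Supp m).
  by apply: (bounded_law_Supp mE) => u; rewrite normr0.
have lV : eq_meas (V m) (pushforward (U01 R) (fun u => (0 : R, sg u))).
  by apply: V_split_rearr mE.
have S01 : Supp (V m) (0, 1).
  move=> U oU U01'.
  have mU := open_measurable_prod oU.
  (* The whole upper half of the levels is sent to [(0, 1)], so every neighbourhood of this point
     has mass at least [1/2]. *)
  rewrite lV//; apply: (@lt_le_trans _ _ (U01 R `[2^-1, +oo[%classic)).
    by rewrite U01_itvcy lte_fin.
  rewrite /pushforward; apply: le_measure; rewrite ?inE//.
    rewrite -[_ @^-1` _]setTI; apply: measurable_fun_pair => //;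
      exact: measurable_sg.
  by move=> u /=; rewrite in_itv/= andbT /sg ltNge => ->.
have := VC (MkPc cS); rewrite -lee_fin => VC'.
apply: (@le_trans _ _ (ereal_sup [set `|p.2|%:E | p in Supp (V m)])).
  by apply: ereal_sup_ubound; exists (0, 1) => //=; rewrite normr1.
apply: le_trans VC' _.
rewrite -[leRHS]mule1; apply: lee_wpmul2l; first by rewrite lee_fin ltW.
rewrite -[leRHS]adde0; apply: leeD2l.
apply: ge_ereal_sup => _ [x /S0 + <-].
by rewrite /= in_itv/= oppr0 => /andP[x0 x0']; rewrite lee_fin ger0_norm.
Qed.

(** The law is built from one rearrangement of [mu]; by almost everywhere uniqueness of
    rearrangements, it is the same for all others. Boundedness of [g] gives the compact support. *)
Lemma ex_flow : exists S : R -> Pc R -> Pc R,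
  forall (t : R) (mu : Pc R) (g : R -> R),
  {homo g : u w / u <= w} -> eq_meas mu (pushforward (U01 R) g) ->
  eq_meas (S t mu) (pushforward (U01 R) (fun u => g u + t * sg u)).
Proof.
suff /choice[S HS] : forall tmu : R * Pc R, exists nu : Pc R, forall g : R -> R,
    {homo g : u w / u <= w} -> eq_meas tmu.2 (pushforward (U01 R) g) ->
    eq_meas nu (pushforward (U01 R) (fun u => g u + tmu.1 * sg u)).
  by exists (fun t mu => S (t, mu)) => t mu; exact: HS (t, mu).
move=> [t mu] /=; have [g [gnd [M gM] mug]] := Pc_rearrangement mu.
have mg := homo_measurable gnd.
have [m mE] := ex_law (measurable_flow t mg).
have gtM u : `|g u + t * sg u| <= M + `|t|.
  by rewrite (le_trans (ler_normD _ _))// lerD// normrM normr_sg mulr1.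
have [_ cS] := bounded_law_Supp mE gtM.
exists (MkPc cS) => h hnd muh A mA /=; rewrite mE//.
have mh := homo_measurable hnd.
apply: ae_eq_law => //; [exact: measurable_flow|exact: measurable_flow|].
by apply: filterS (rearr_ae_unique gnd hnd mug muh) => u ->.
Qed.

Lemma flow_LAS_limit (T : R) (mu0 : Pc R) (mu : R -> Pc R) (g : R -> R) :
  0 < T -> {homo g : u w / u <= w} -> (exists M : R, forall u, `|g u| <= M) ->
  eq_meas mu0 (pushforward (U01 R) g) ->
  (forall t, 0 <= t <= T ->
     eq_meas (mu t) (pushforward (U01 R) (fun u => g u + t * sg u))) ->
  LAS_converge V T id mu0 mu /\ LAS_limit V T mu0 mu.
Proof.
move=> T0 gnd [M gM] mu0g muE.
have H := LAS_converge_law gnd gM mu0g T0 muE.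
by split => //; exists id.
Qed.

Variable S : R -> Pc R -> Pc R.
Hypothesis SE : forall (t : R) (mu : Pc R) (g : R -> R),
  {homo g : u w / u <= w} -> eq_meas mu (pushforward (U01 R) g) ->
  eq_meas (S t mu) (pushforward (U01 R) (fun u => g u + t * sg u)).

(** For the semigroup law, [g + s * sg] is itself a nondecreasing rearrangement of [S s mu], to
    which the description of the flow applies a second time. *)
Lemma flow_Lipschitz_semigroup (C T : R) : 0 < C -> support_sublinear V C ->
  Lipschitz_semigroup V C T S.
Proof.
move=> C0 VC; have C1 := support_sublinear_ge1 C0 VC.
split.
- split=> [mu A mA|mu t s t0 s0 _ A mA];
  have [g [gnd _ mug]] := Pc_rearrangement mu.
    by rewrite (SE _ gnd mug)// flow0 mug.
  rewrite (SE _ (homo_flow gnd s0) (SE _ gnd mug))// (SE _ gnd mug)//.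
  rewrite (_ : (fun u => _) = (fun u => g u + (t + s) * sg u))//.
  by apply/funext => u; rewrite mulrDl addrA addrAC.
- move=> mu; have [g [gnd _ mug]] := Pc_rearrangement mu.
  by apply: (flow_is_solution gnd) => t _; exact: SE.
(* The constant is independent of [r]: the flow preserves [W1], which is at most multiplied by
   [expR t], and it moves mass at unit speed. *)
- move=> r r0; exists 1 => // mu nu Smu Snu t s.
  rewrite !in_itv/= => /andP[t0 _] /andP[s0 _].
  have [g [gnd gr mug]] := ex_rearrangement r0 Smu.
  have [h [hnd _ nuh]] := ex_rearrangement r0 Snu.
  have mg := homo_measurable gnd; have mh := homo_measurable hnd.
  split.
  + have gtr u : `|g u + t * sg u| <= r + t.
      rewrite (le_trans (ler_normD _ _))// lerD// normrM normr_sg mulr1.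
      by rewrite ger0_norm.
    have [St _] := bounded_law_Supp (SE _ gnd mug) gtr.
    apply: subset_trans St _; rewrite ball_itv sub0r add0r.
    have e1 : 1 + t <= expR (C * t).
      by rewrite (le_trans _ (expR_ge1Dx _))// lerD2l ler_peMl.
    (* The ball being open, a strict bound is needed: [(1 + t) * (r + 1)] exceeds [r + t] by
       [1 + t * r]. The factor [1 + t] is below the exponential because [C] is at least [1]. *)
    have rt : r + t < expR (C * t) * (r + 1).
      by apply: lt_le_trans (_ : (1 + t) * (r + 1) <= expR (C * t) * (r + 1));
        [nra|rewrite ler_pM2r//; lra].
    by apply: subset_itv; rewrite bnd_simp ?ltrN2.
  + rewrite (W1E (homo_flow gnd t0) (homo_flow hnd t0) (SE _ gnd mug) (SE _ hnd
    nuh)).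
    rewrite (W1E gnd hnd mug nuh).
    under eq_integral do rewrite opprD addrACA subrr addr0.
    rewrite lee_pemull ?integral_ge0// lee_fin.
    by rewrite (le_trans _ (expR_ge1Dx _))// lerDl mul1r.
  + rewrite (W1E (homo_flow gnd t0) (homo_flow gnd s0) (SE _ gnd mug) (SE _ gnd
    mug)).
    apply: L1_le_cst; [exact: measurable_flow|exact: measurable_flow|move=> u].
    by rewrite opprD addrACA subrr add0r -mulrBl normrM normr_sg mulr1 mul1r.
Qed.

End split_field.

Theorem proposition7p2 (R : realType) :
  let V := @V_split R in
  is_PVF V /\
  (exists2 C : R, 0 < C & support_sublinear V C) /\
  locally_calW_Lipschitz V /\
  (forall (T : R) (mu0 : Pc R), 0 < T -> LAS_unique_limit V T mu0) /\
  (forall C T : R, 0 < C -> support_sublinear V C -> 0 < T ->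
     exists2 S : R -> Pc R -> Pc R, LAS_semigroup V C T S &
       forall S' : R -> Pc R -> Pc R, LAS_semigroup V C T S' ->
         forall (t : R) (mu : Pc R), t \in `[0, T] ->
           eq_meas (S' t mu) (S t mu)) /\
  (forall (T : R) (mu0 : Pc R) (mu : R -> Pc R), 0 < T ->
     LAS_limit V T mu0 mu ->
     [/\ is_solution V T mu,
         eq_meas (mu 0) mu0 &
         forall t : R, t \in `[0, T] ->
         [/\ forall A : set R, measurable A ->
               mu t A =
                 (mu0 ((fun x => (x + t)%R) @`
                         (A `&` `]-oo, (Bpt mu0 - t)%R[)) +
                  mu0 ((fun x => (x - t)%R) @`
                         (A `&` `](Bpt mu0 + t)%R, +oo[)) +
                  (eta_of mu0)%:E * \d_(Bpt mu0 + t)%R A +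
                  ((2^-1)%:E - mu0 `]-oo, Bpt mu0[%classic) *
                    \d_(Bpt mu0 - t)%R A)%E,
             forall x0 : R, eq_meas mu0 \d_x0 ->
               forall A : set R, measurable A ->
               mu t A = ((2^-1)%:E * \d_(x0 + t)%R A +
                         (2^-1)%:E * \d_(x0 - t)%R A)%E &
             forall a b : R, a < b ->
               eq_meas mu0 (fun A =>
                 \int[lebesgue_measure]_(x in A)
                   ((b - a)^-1 * \1_(`[a, b]%classic) x)%:E)%E ->
               forall A : set R, measurable A ->
               mu t A =
                 (\int[lebesgue_measure]_(x in A)
                   ((b - a)^-1 *
                    (\1_(`[a - t, (a + b) / 2 - t]%classic) x +
                     \1_(`[(a + b) / 2 + t, b + t]%classic) x))%:E)%E]]).
Proof.
move=> V; split; first exact: split_is_PVF.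
split; first by exists 1 => //; exact: split_support_sublinear.
split; first exact: split_locally_calW_Lipschitz.
have [S SE] := ex_flow R.
have limit_law T (mu0 : Pc R) (mu : R -> Pc R) (g : R -> R) : 0 < T ->
    LAS_limit V T mu0 mu -> {homo g : u w / u <= w} ->
    (exists M : R, forall u, `|g u| <= M) ->
    eq_meas mu0 (pushforward (U01 R) g) -> forall t, 0 <= t <= T ->
    eq_meas (mu t) (pushforward (U01 R) (fun u => g u + t * sg u)).
  by move=> T0 lim gnd [M gM] mu0g; exact: (LAS_limit_law gnd gM mu0g T0 lim).
split.
  move=> T mu0 T0; have [g [gnd gM mu0g]] := Pc_rearrangement mu0.
  have SEg t : 0 <= t <= T ->
    eq_meas (S t mu0) (pushforward (U01 R) (fun u => g u + t * sg u)).
    by move=> _; exact: SE.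
  exists (fun t => S t mu0).
    by have [] := flow_LAS_limit T0 gnd gM mu0g SEg.
  move=> mu' lim t; rewrite in_itv/= => tT A mA.
  by rewrite (limit_law _ _ _ _ T0 lim gnd gM mu0g)// SEg.
split.
  move=> C T C0 VC T0; exists S.
    split; first exact: flow_Lipschitz_semigroup.
    move=> mu0; have [g [gnd gM mu0g]] := Pc_rearrangement mu0.
    by have [] := flow_LAS_limit T0 gnd gM mu0g (fun t _ =>
      SE t mu0 g gnd mu0g).
  (* The trajectories of [S'] are limits of lattice approximate solutions, so their laws are
     prescribed by [limit_law]. *)
  move=> S' [_ lim] t mu; rewrite in_itv/= => tT A mA.
  have [g [gnd gM mug]] := Pc_rearrangement mu.
  by rewrite (limit_law _ _ _ _ T0 (lim mu) gnd gM mug)// (SE _ _ _ gnd mug).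
move=> T mu0 mu T0 lim; have [g [gnd gM mu0g]] := Pc_rearrangement mu0.
have muE := limit_law _ _ _ _ T0 lim gnd gM mu0g.
split.
- exact: flow_is_solution gnd muE.
- by move=> A mA; rewrite muE ?lexx ?ltW// flow0 mu0g.
- move=> t; rewrite in_itv/= => tT; split.
  + by move=> A mA; rewrite muE// (flow_formula gnd mu0g).
  + move=> x0 mu0x A mA.
    (* The law of the limit may be read from any rearrangement of [mu0]; here the constant one
       replaces [g]. *)
    have x0nd : {homo (fun=> x0) : u w / u <= w :> R} by [].
    rewrite (limit_law _ _ _ _ T0 lim x0nd _ (dirac_law mu0x))//.
      exact: dirac_flow.
    by exists `|x0|.
  + by move=> a b ab mu0ab A mA; rewrite muE// (uniform_flow ab mu0ab).
Qed.
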